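(* Suppose $X$ is a polyhedron and $\Lambda_X(\mathcal{A})$ is nonempty. Then $\Lambda_X^\star(\mathcal{A})$ is finite and \[C_X(\mathcal{A})=\sum_{\lambda\in\Lambda_X^\star(\mathcal{A})}C_X(\mathcal{A},\lambda)\quad\text{(Minkowski sum)}.\] Moreover, there is no proper subset $\Lambda\subsetneq\Lambda_X^\star(\mathcal{A})$ for which $C_X(\mathcal{A})=\sum_{\lambda\in\Lambda}C_X(\mathcal{A},\lambda)$.
   Context: $X\subset\mathbb{R}^n$ is a nonempty closed convex set and $\mathcal{A}\subset\mathbb{R}^n$ is a nonempty finite set such that the functions $x\mapsto\exp(\alpha^Tx)$, $\alpha\in\mathcal{A}$, are linearly independent on $X$. $\mathbb{R}^{\mathcal{A}}$ denotes real vectors indexed by $\mathcal{A}$. $\mathcal{A}\nu=\sum_\alpha\alpha\nu_\alpha$. $\sigma_X(y)=\sup\{y^Tx:x\in X\}$. $N_\beta=\{\nu\in\mathbb{R}^{\mathcal{A}}:\nu_\alpha\ge0\ \forall\alpha\neq\beta,\ \sum_\alpha\nu_\alpha=0\}$. A vector $\nu^\star\in N_\beta$ is an $X$-circuit of $\mathcal{A}$ if (1) $\nu^\star\neq0$, (2) $\sigma_X(-\mathcal{A}\nu^\star)<\infty$, and (3) $\nu^\star$ cannot be written as a convex combination of two non-proportional vectors $\nu^{(1)},\nu^{(2)}\in N_\beta$ such that the map $\nu\mapsto\sigma_X(-\mathcal{A}\nu)$ is affine on the segment $[\nu^{(1)},\nu^{(2)}]$. $\Lambda_X(\mathcal{A})$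 is the set of all $X$-circuits $\lambda$ (over all $\beta\in\mathcal{A}$) normalized so that the unique negative entry equals $-1$. The functional form of $\lambda\in\Lambda_X(\mathcal{A})$ is $\phi_\lambda=(\lambda,\sigma_X(-\mathcal{A}\lambda))\in\mathbb{R}^{\mathcal{A}}\times\mathbb{R}$. The circuit graph is $G_X(\mathcal{A})=\operatorname{cone}(\{\phi_\lambda:\lambda\in\Lambda_X(\mathcal{A})\}\cup\{(0,1)\})$. The set of normalized reduced $X$-circuits $\Lambda_X^\star(\mathcal{A})$ consists of those $\lambda\in\Lambda_X(\mathcal{A})$ for which $\{t\phi_\lambda:t\ge0\}$ is an extreme ray of $G_X(\mathcal{A})$. Signomials $f=\sum_\alpha c_\alpha\mathrm{e}^\alpha$, $\mathrm{e}^\alpha(x)=\exp(\alpha^Tx)$, are identified with $c\in\mathbb{R}^{\mathcal{A}}$; $C_X(\mathcal{A},\beta)$ is the set of $c$ with $f$ nonnegative on $X$ and $c_\alpha\ge0$ for $\alpha\ne\beta$, and $C_X(\mathcal{A})=\sum_{\beta\in\mathcal{A}}C_X(\mathcal{A},\beta)$. For $\lambda\in\Lambda_X(\mathcal{A})$ with negative index $\beta$ and $\lambda^+=\{\alpha:\lambda_\alpha>0\}$, the $\lambda$-witnessed AGE cone is $C_X(\mathcal{A},\lambda)=\{c: c_\alpha\ge0\ \forall\alpha\neq\beta,\ \prod_{\alpha\in\lambda^+}(c_\alpha/\lambda_\alpha)^{\lambda_\alpha}\ge -c_\beta\exp(\sigma_X(-\mathcal{A}\lambda))\}$. *)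

(* Defs.v *)
From HB Require Import structures.
From mathcomp Require Import all_boot all_order all_algebra.
From mathcomp Require Import all_classical all_reals all_analysis.
Set Implicit Arguments. Unset Strict Implicit. Unset Printing Implicit Defensive.
Import Order.TTheory GRing.Theory Num.Theory.
Local Open Scope classical_set_scope.
Local Open Scope ring_scope.

(* Conventions:
   - points of R^n are row vectors 'rV[R]_n;
   - the finite exponent set A = {alpha_0, ..., alpha_(m-1)} is given by the
     matrix A : 'M[R]_(m,n) whose i-th row is alpha_i;
   - R^A is 'rV[R]_m (coordinate i <-> alpha_i);
   - the vector  \mathcal{A} nu = sum_alpha alpha nu_alpha  is  nu *m A. *)

Section Defs.
Variables (R : realType) (n m : nat).

Definition dotp (y x : 'rV[R]_n) : R := \sum_(j < n) y 0 j * x 0 j.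

Definition polyhedron (X : set 'rV[R]_n) : Prop :=
  exists (k : nat) (G : 'M[R]_(k, n)) (h : 'rV[R]_k),
    X = [set x | forall j : 'I_k, dotp (row j G) x <= h 0 j].

Definition suppf (X : set 'rV[R]_n) (y : 'rV[R]_n) : \bar R :=
  ereal_sup [set (dotp y x)%:E | x in X].

Definition signomial (A : 'M[R]_(m, n)) (c : 'rV[R]_m) (x : 'rV[R]_n) : R :=
  \sum_(i < m) c 0 i * expR (dotp (row i A) x).

Definition exp_lin_indep (X : set 'rV[R]_n) (A : 'M[R]_(m, n)) : Prop :=
  forall c : 'rV[R]_m, (forall x, X x -> signomial A c x = 0) -> c = 0.

Variables (X : set 'rV[R]_n) (A : 'M[R]_(m, n)).

Definition sigA (nu : 'rV[R]_m) : \bar R := suppf X (- (nu *m A)).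

Definition Nset (beta : 'I_m) : set 'rV[R]_m :=
  [set nu : 'rV[R]_m | (forall a, a != beta -> 0 <= nu 0 a) /\ \sum_(a < m) nu 0 a = 0].

Definition proportional (u v : 'rV[R]_m) : Prop :=
  exists t : R, u = t *: v \/ v = t *: u.

Definition affine_on_segment (nu1 nu2 : 'rV[R]_m) : Prop :=
  sigA nu1 \is a fin_num /\ sigA nu2 \is a fin_num /\
  forall t : R, 0 <= t <= 1 ->
    sigA ((1 - t) *: nu1 + t *: nu2) = ((1 - t)%:E * sigA nu1 + t%:E * sigA nu2)%E.

Definition Xcircuit (beta : 'I_m) (nu : 'rV[R]_m) : Prop :=
  [/\ Nset beta nu, nu != 0, (sigA nu < +oo%E)%E &
   ~ exists (nu1 nu2 : 'rV[R]_m) (th : R),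
       [/\ Nset beta nu1 /\ Nset beta nu2, 0 < th < 1,
           nu = (1 - th) *: nu1 + th *: nu2,
           ~ proportional nu1 nu2 & affine_on_segment nu1 nu2]].

Definition Lambda : set 'rV[R]_m :=
  [set lam : 'rV[R]_m | exists beta, Xcircuit beta lam /\ lam 0 beta = -1].

Definition phi (lam : 'rV[R]_m) : 'rV[R]_m * R := (lam, fine (sigA lam)).

(* circuit graph G_X(A) = cone({phi_lam} U {(0,1)}) (conic hull) *)
Definition circuit_graph : set ('rV[R]_m * R) :=
  [set p : 'rV[R]_m * R | exists (k : nat) (t : 'I_k -> R) (l : 'I_k -> 'rV[R]_m) (t0 : R),
     [/\ forall i, 0 <= t i /\ Lambda (l i), 0 <= t0,
         p.1 = \sum_(i < k) t i *: l i &
         p.2 = \sum_(i < k) t i * fine (sigA (l i)) + t0]].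

Definition on_ray (v p : 'rV[R]_m * R) : Prop :=
  exists s : R, [/\ 0 <= s, p.1 = s *: v.1 & p.2 = s * v.2].

Definition extreme_ray (K : set ('rV[R]_m * R)) (v : 'rV[R]_m * R) : Prop :=
  [/\ v.1 != 0 \/ v.2 != 0, K v &
   forall u w, K u -> K w -> on_ray v (u.1 + w.1, u.2 + w.2) ->
     on_ray v u /\ on_ray v w].

Definition Lambda_star : set 'rV[R]_m :=
  [set lam : 'rV[R]_m | Lambda lam /\ extreme_ray circuit_graph (phi lam)].

Definition sage_cone (beta : 'I_m) : set 'rV[R]_m :=
  [set c : 'rV[R]_m | (forall a, a != beta -> 0 <= c 0 a) /\
           forall x, X x -> 0 <= signomial A c x].

Definition sage_cone_all : set 'rV[R]_m :=
  [set c : 'rV[R]_m | exists d : 'I_m -> 'rV[R]_m,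
     (forall beta, sage_cone beta (d beta)) /\ c = \sum_(beta < m) d beta].

(* lambda-witnessed AGE cone C_X(A, lambda); beta is the (unique) index with
   lam_beta < 0 *)
Definition age_cone (lam : 'rV[R]_m) : set 'rV[R]_m :=
  [set c : 'rV[R]_m | (forall a, 0 <= lam 0 a -> 0 <= c 0 a) /\
     forall beta, lam 0 beta < 0 ->
       \prod_(a < m | 0 < lam 0 a) ((c 0 a / lam 0 a) `^ (lam 0 a))
         >= - c 0 beta * expR (fine (sigA lam))].

Definition minkowski_sum (L : set 'rV[R]_m) (C : 'rV[R]_m -> set 'rV[R]_m)
  : set 'rV[R]_m :=
  [set c : 'rV[R]_m | exists d : 'rV[R]_m -> 'rV[R]_m,
     (forall lam, L lam -> C lam (d lam)) /\ c = \sum_(lam \in L) d lam].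

End Defs.

(* Main.v *)
Require Import Defs.
From HB Require Import structures.
From mathcomp Require Import all_boot all_order all_algebra.
From mathcomp Require Import all_classical all_reals all_analysis.
From mathcomp Require Import ring lra.
Import Order.TTheory GRing.Theory Num.Theory.
Import numFieldNormedType.Exports.
Local Open Scope classical_set_scope.
Local Open Scope ring_scope.

(** For each [b] let [E_b] be the epigraph of [nu |-> sigma_X (- A nu)] over [N_b].
    As [X] is polyhedral, [E_b] is a pointed, finitely generated cone, and each of its
    extreme rays is spanned by [(0, 1)] or by [phi_lam] for a normalized circuit [lam].
    Hence the circuit graph [G] is the sum of the [E_b]; it is pointed because the
    exponentials are linearly independent on [X], so it is generated by [(0, 1)] and
    its finitely many extreme rays [phi_lam] with [lam] reduced.

    Let [f] be nonnegative on [X] with negative coefficient at most at [b].  If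
    [f / e^b] attains its minimum over [X] at [x0], the first-order condition gives an
    element of [E_b] that is tight at [x0]; all the reduced circuits that generate it
    are then tight at [x0] as well, and weighting them by the exponentials
    [exp (- (alpha_a - alpha_b) x0)] splits [f] into witnessed AGE signomials.  If the
    minimum is not attained, Farkas' lemma provides a recession direction of [X] along
    which some terms vanish, and these terms can be dropped from [f].

    For minimality, if [lam0] is left out, then [phi_lam0] is not in the cone generated
    by the remaining [phi_lam] and [(0, 1)].  A separating functional [(y, 1)] turns
    into the functional [c |-> sum_a c_a exp (y_a)], which is nonnegative on all the
    remaining AGE cones but negative at some point of the one of [lam0]. *)

Set Implicit Arguments. Unset Strict Implicit. Unset Printing Implicit Defensive.

(** * Conic hulls and extreme rays *)

Section ConicHull.
Variables (R : realType) (V : lmodType R).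
Implicit Types (S T : set V) (u v w : V).

(** Adding one generator at a time turns facts about finite nonnegative combinations into
    inductions; [S] may be infinite. *)
Inductive conic_hull S : set V :=
| conic_hull0 : conic_hull S 0
| conic_hull_cons t s v :
    S s -> 0 <= t -> conic_hull S v -> conic_hull S (t *: s + v).

Lemma conic_hullD S u v : conic_hull S u -> conic_hull S v -> conic_hull S (u + v).
Proof.
elim=> [|t s w Ss t0 _ IH] hv; first by rewrite add0r.
by rewrite -addrA; apply: conic_hull_cons => //; exact: IH.
Qed.

Lemma conic_hullZ S t v : 0 <= t -> conic_hull S v -> conic_hull S (t *: v).
Proof.
move=> t0; elim=> [|r s w Ss r0 _ IH]; first by rewrite scaler0; constructor.
by rewrite scalerDr scalerA; apply: conic_hull_cons => //; exact: mulr_ge0.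
Qed.

Lemma sub_conic_hull S : S `<=` conic_hull S.
Proof.
move=> s Ss; rewrite -[s]addr0 -[s]scale1r.
by apply: conic_hull_cons => //; constructor.
Qed.

Lemma conic_hull_min S T : S `<=` conic_hull T -> conic_hull S `<=` conic_hull T.
Proof.
move=> ST v; elim=> [|t s w Ss t0 _ IH]; first by constructor.
by apply: conic_hullD => //; apply: conic_hullZ => //; exact: ST.
Qed.

Lemma conic_hull_sub S T : S `<=` T -> conic_hull S `<=` conic_hull T.
Proof. by move=> ST; apply: conic_hull_min => v /ST; exact: sub_conic_hull. Qed.

Lemma conic_hull_split S s v : conic_hull S v ->
  exists t w, [/\ 0 <= t, conic_hull (S `\ s) w & v = t *: s + w].
Proof.
elim=> [|t r w Sr t0 _ [q [x [q0 hx ->]]]].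
  by exists 0, 0; split => //; [constructor | rewrite scale0r addr0].
have [->|rs] := eqVneq r s.
  by exists (t + q), x; split=> //; [exact: addr_ge0|rewrite scalerDl addrA].
exists q, (t *: r + x); split => //; last by rewrite addrCA.
by apply: conic_hull_cons => //; split => //=; exact/eqP.
Qed.

(** Deleting a generator that lies in the hull of the others keeps the hull and shortens the
    list. *)
Lemma irredundant_generators (s : seq V) : exists s' : seq V,
  [/\ {subset s' <= s}, [set` s] `<=` conic_hull [set` s'] &
      forall v, v \in s' -> ~ conic_hull ([set` s'] `\ v) v].
Proof.
have [n] := ubnP (size s); elim: n s => // n IH s; rewrite ltnS => sn.
have [[v [vs hv]]|irr] := pselect (exists v, v \in s /\ conic_hull ([set` s] `\ v) v);
  last first.
  exists s; split=> //; first exact: sub_conic_hull.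
  by move=> v vs hv; apply: irr; exists v.
have subE : [set` s] `\ v `<=` [set` [seq x <- s | x != v]].
  by move=> x /= [xs /eqP xv]; rewrite mem_filter xv.
have [|s' [s's hs' irr']] := IH [seq x <- s | x != v].
  apply: leq_trans sn; rewrite size_filter -(count_predC (pred1 v)) -addn1 addnC.
  by rewrite leq_add2r -has_count has_pred1.
exists s'; split=> //.
  by move=> x /s's; rewrite mem_filter => /andP[].
move=> x xs; have [->|xv] := eqVneq x v.
  by apply: conic_hull_min hv => y /subE; exact: hs'.
by apply: hs'; rewrite /= mem_filter xv.
Qed.

Definition ray v : set V := [set u | exists2 r, 0 <= r & u = r *: v].

Definition extremal (K : set V) v :=
  [/\ v != 0, K v & forall u w, K u -> K w -> ray v (u + w) -> ray v u /\ ray v w].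

Definition pointed (K : set V) := forall v, K v -> K (- v) -> v = 0.

(** Extremality puts every summand of a combination representing [w] on the ray of [v]; as [w] is
    nonzero, some summand is nonzero, and its generator is then a positive multiple of [v]. *)
Lemma extremal_generator S (K : set V) v w : S `<=` K -> K = conic_hull K ->
  extremal K v -> conic_hull S w -> w != 0 -> ray v w ->
  exists2 s, S s & exists2 r, 0 < r & s = r *: v.
Proof.
move=> SK KK [v0 Kv ext]; elim=> [|t s x Ss t0 hx IH]; first by rewrite eqxx.
move=> nz rv.
have KSx : K x by rewrite KK; apply: conic_hull_sub hx.
have KSs : K (t *: s).
  by rewrite KK; apply: conic_hullZ => //; apply: sub_conic_hull; exact: SK.
have [[r r0 ts] rx] := ext _ _ KSs KSx rv.
have [ts0|tsn0] := eqVneq (t *: s) 0.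
  by apply: IH => //; apply: contraNneq nz => ->; rewrite ts0 addr0.
exists s => //.
have tn0 : t != 0 by apply: contraNneq tsn0 => ->; rewrite scale0r.
have rn0 : r != 0 by apply: contraNneq tsn0 => rr; rewrite ts rr scale0r.
exists (t^-1 * r).
  by rewrite mulr_gt0 ?invr_gt0 // lt_neqAle eq_sym ?tn0 ?rn0.
by rewrite -scalerA -ts scalerA mulVf // scale1r.
Qed.

(** If [u + w] lies on the ray of [s], remove the [s]-components of [u] and [w]. A positive multiple
    of [s] left over would express [s] by the other generators; otherwise pointedness kills both
    remainders. *)
Lemma irredundant_extremal (S : set V) s : pointed (conic_hull S) -> S s ->
  ~ conic_hull (S `\ s) s -> extremal (conic_hull S) s.
Proof.
move=> ptd Ss irr; split; [|exact: sub_conic_hull|].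
  by apply: contra_notN irr => /eqP ->; constructor.
move=> u w Ku Kw [r r0 uw].
have [a [u' [a0 hu' Eu]]] := conic_hull_split s Ku.
have [b [w' [b0 hw' Ew]]] := conic_hull_split s Kw.
have sumE : u' + w' = (r - a - b) *: s.
  have -> : u' + w' = (u + w) - a *: s - b *: s.
    by rewrite Eu Ew addrACA -[_ - _ - _]addrA -opprD [X in X - _]addrC addrK.
  by rewrite uw -!scalerBl.
have [lt|ge] := ltP 0 (r - a - b).
  exfalso; apply: irr.
  suff : conic_hull (S `\ s) ((r - a - b)^-1 *: (u' + w')).
    by rewrite sumE scalerA mulVf ?scale1r // gt_eqF.
  by apply: conic_hullZ; [rewrite invr_ge0 ltW | exact: conic_hullD].
have sub : conic_hull (S `\ s) `<=` conic_hull S by apply: conic_hull_sub => x [].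
have aux x y : conic_hull S x -> conic_hull S y -> x + y = (r - a - b) *: s -> x = 0.
  move=> hx hy xy; apply: ptd => //.
  have -> : - x = (- (r - a - b)) *: s + y.
    by rewrite scaleNr -xy opprD addrNK.
  by apply: conic_hull_cons => //; rewrite oppr_ge0.
have u0 := aux _ _ (sub _ hu') (sub _ hw') sumE.
have w0 : w' = 0 by apply: (aux _ u') => //; [exact: sub|exact: sub|rewrite addrC].
by rewrite Eu Ew u0 w0 !addr0; split; [exists a|exists b].
Qed.

Lemma pointed_hull_extremal_generators (K : set V) (s : seq V) :
  K = conic_hull [set` s] -> pointed K ->
  exists s' : seq V, K = conic_hull [set` s'] /\ forall v, v \in s' -> extremal K v.
Proof.
move=> Ks ptd; have [s' [s's hs' irr]] := irredundant_generators s.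
have Ks' : K = conic_hull [set` s'].
  rewrite Ks; apply/seteqP; split; first exact: conic_hull_min.
  by apply: conic_hull_sub => x /=; exact: s's.
exists s'; split=> // v vs'; rewrite Ks'; apply: irredundant_extremal => //.
  by rewrite -Ks'.
exact: irr.
Qed.

(* For each support pattern [J] that occurs, one witness [g J] is chosen:
   subtracting from a vector the largest possible multiple of the witness with
   the same support makes the support strictly smaller. *)
Lemma polyhedral_cone_finite_hull (I : finType) (f : I -> V -> R) (P : set V) :
  (forall i t u v, f i (t *: u + v) = t * f i u + f i v) ->
  P 0 -> (forall t u v, P u -> P v -> P (t *: u + v)) ->
  (forall v, P v -> (forall i, f i v = 0) -> v = 0) ->
  exists s : seq V, [set v | P v /\ forall i, 0 <= f i v] = conic_hull [set` s].
Proof.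
move=> flin P0 Plin inj; set K := [set v | _].
have f0 i : f i 0 = 0 by have := flin i 1 0 0; rewrite scaler0 addr0 mul1r; lra.
have K0 : K 0 by split=> // i; rewrite f0.
pose supp v : {set I} := [set i | f i v != 0]%SET.
have /choice[g gP] : forall J : {set I}, exists w,
    K w /\ ((exists2 v, K v & supp v = J) -> supp w = J).
  move=> J.
  have [[v Kv vJ]|nJ] := pselect (exists2 v, K v & supp v = J).
    by exists v.
  by exists 0; split.
exists [seq g J | J : {set I}]; apply/seteqP; split; last first.
  move=> v; elim=> [//|t s w /= sI t0 _ [Pw fw]].
  case/mapP: sI => J _ sE; have [[Pg fg] _] := gP J.
  split; first by apply: Plin => //; rewrite sE.
  by move=> i; rewrite flin sE addr_ge0 // mulr_ge0.
move=> v; have [n] := ubnP #|supp v|; elim: n v => // n IH v; rewrite ltnS => vn Kv.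
have [->|v0] := eqVneq v 0; first by constructor.
have [[Pw fw] /(_ (ex_intro2 _ _ v Kv erefl)) wv] := gP (supp v).
set w := g (supp v) in Pw fw wv.
have [Pv fv] := Kv.
have [i0 i0v] : exists i, i \in supp v.
  apply: contrapT => /forallNP nv; move/eqP: v0; apply; apply: inj => // i.
  by have /negP := nv i; rewrite inE negbK => /eqP.
have wpos i : i \in supp v -> 0 < f i w.
  by rewrite -wv inE => wi; rewrite lt_neqAle eq_sym wi fw.
(* Subtracting [w] with the minimal ratio keeps every form nonnegative and makes the form [j]
   vanish. *)
case: (arg_minP (fun i => f i v / f i w) i0v) => j jv jmin.
set th := f j v / f j w in jmin.
have th0 : 0 <= th by rewrite divr_ge0.
have fE i : f i (v - th *: w) = f i v - th * f i w.
  by rewrite addrC -scaleNr flin mulNr addrC.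
have Kx : K (v - th *: w).
  split; first by rewrite addrC -scaleNr; exact: Plin.
  move=> i; rewrite fE; case: (boolP (i \in supp v)) => iv.
    by rewrite subr_ge0 -ler_pdivlMr ?wpos //; exact: jmin.
  have : i \notin supp w by rewrite wv.
  by rewrite inE negbK => /eqP ->; rewrite mulr0 subr0.
have hx : conic_hull [set` [seq g J | J : {set I}]] (v - th *: w).
  apply: IH => //; apply: leq_trans vn; apply: proper_card.
  apply/properP; split.
    apply/fintype.subsetP => i; apply: contraLR => iv.
    have : i \notin supp w by rewrite wv.
    move: iv; rewrite !inE !negbK fE => /eqP -> /eqP ->.
    by rewrite mulr0 subrr.
  exists j => //; rewrite inE negbK fE /th divfK ?subrr //.
  by rewrite gt_eqF // wpos.
rewrite -(subrK (th *: w) v) addrC; apply: conic_hull_cons => //.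
by rewrite /= map_f // mem_enum.
Qed.

End ConicHull.

Lemma conic_hull_image (R : realType) (V W : lmodType R) (f : {linear V -> W})
    (S : set V) : conic_hull (f @` S) = f @` conic_hull S.
Proof.
apply/seteqP; split.
  move=> w; elim=> [|t _ x [s Ss <-] t0 _ [v hv <-]].
    by exists 0; [constructor|rewrite linear0].
  by exists (t *: s + v); [exact: conic_hull_cons|rewrite linearP].
move=> _ [v hv <-]; elim: hv => [|t s x Ss t0 _ IH].
  by rewrite linear0; constructor.
by rewrite linearP; apply: conic_hull_cons => //; exists s.
Qed.

(** * Farkas' lemma *)

Section Dotp.
Variables (R : realType) (n : nat).
Implicit Types (x y z : 'rV[R]_n) (t : R).

Lemma dotpC x y : dotp x y = dotp y x.
Proof. by apply: eq_bigr => j _; rewrite mulrC. Qed.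

Lemma dotpDl x y z : dotp (x + y) z = dotp x z + dotp y z.
Proof. by rewrite -big_split; apply: eq_bigr => j _; rewrite mxE mulrDl. Qed.

Lemma dotpZl t x z : dotp (t *: x) z = t * dotp x z.
Proof. by rewrite mulr_sumr; apply: eq_bigr => j _; rewrite mxE mulrA. Qed.

Lemma dotpNl x z : dotp (- x) z = - dotp x z.
Proof. by rewrite -scaleN1r dotpZl mulN1r. Qed.

Lemma dotpBl x y z : dotp (x - y) z = dotp x z - dotp y z.
Proof. by rewrite dotpDl dotpNl. Qed.

Lemma dotp0l x : dotp 0 x = 0.
Proof. by rewrite -(scale0r x) dotpZl mul0r. Qed.

Lemma dotp0r x : dotp x 0 = 0.
Proof. by rewrite dotpC dotp0l. Qed.

Lemma dotpDr x y z : dotp z (x + y) = dotp z x + dotp z y.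
Proof. by rewrite dotpC dotpDl !(dotpC _ z). Qed.

Lemma dotpZr t x z : dotp z (t *: x) = t * dotp z x.
Proof. by rewrite dotpC dotpZl dotpC. Qed.

Lemma dotpBr x y z : dotp z (x - y) = dotp z x - dotp z y.
Proof. by rewrite dotpC dotpBl !(dotpC _ z). Qed.

Lemma dotp_suml (I : Type) (r : seq I) (P : pred I) (F : I -> 'rV[R]_n) z :
  dotp (\sum_(i <- r | P i) F i) z = \sum_(i <- r | P i) dotp (F i) z.
Proof.
by elim/big_rec2: _ => [|i a b _ <-]; rewrite ?dotp0l ?dotpDl.
Qed.

Lemma dotp_ge0 x : 0 <= dotp x x.
Proof. by apply: sumr_ge0 => j _; rewrite -expr2 sqr_ge0. Qed.

Lemma dotp_eq0 x : dotp x x = 0 -> x = 0.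
Proof.
move=> x0; apply/rowP => j; rewrite mxE; apply/eqP; rewrite -sqrf_eq0 expr2.
by rewrite (psumr_eq0P _ x0) // => i _; rewrite -expr2 sqr_ge0.
Qed.

Lemma dotp_mulmx m (nu : 'rV[R]_m) (A : 'M[R]_(m, n)) x :
  dotp (nu *m A) x = \sum_(a < m) nu 0 a * dotp (row a A) x.
Proof.
by rewrite mulmx_sum_row dotp_suml; apply: eq_bigr => a _; rewrite dotpZl.
Qed.

End Dotp.

Section Farkas.
Variables (R : realType) (n : nat).
(** [R^o] is [R] as a module over itself, so that the pairs form a module and conic hulls apply to
    them. *)
Let V := ('rV[R]_n * R^o)%type.

Definition pdot (p q : V) : R := dotp p.1 q.1 + p.2 * q.2.

Lemma pdotDl (p p' q : V) : pdot (p + p') q = pdot p q + pdot p' q.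
Proof. by rewrite /pdot /= dotpDl mulrDl addrACA. Qed.

Lemma pdotZl t (p q : V) : pdot (t *: p) q = t * pdot p q.
Proof. by rewrite /pdot /= dotpZl mulrDr mulrA. Qed.

Lemma pdotC (p q : V) : pdot p q = pdot q p.
Proof. by rewrite /pdot dotpC mulrC. Qed.

Lemma pdotBl (p p' q : V) : pdot (p - p') q = pdot p q - pdot p' q.
Proof. by rewrite pdotDl -scaleN1r pdotZl mulN1r. Qed.

Lemma pdotBr (p p' q : V) : pdot q (p - p') = pdot q p - pdot q p'.
Proof. by rewrite pdotC pdotBl !(pdotC _ q). Qed.

Lemma pdotZr t (p q : V) : pdot q (t *: p) = t * pdot q p.
Proof. by rewrite pdotC pdotZl pdotC. Qed.

(* Bartl's induction: if [s] is violated by a point [q] satisfying the other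
   constraints, project the remaining functionals along [s] so that they vanish
   at [q]. *)
Lemma farkas (s : seq V) (b : V) :
  (forall q, (forall a, a \in s -> pdot a q <= 0) -> pdot b q <= 0) ->
  conic_hull [set` s] b.
Proof.
have [k] := ubnP (size s); elim: k s b => // k IH [|a s] b /= sk imp.
  suff -> : b = 0 by constructor.
  have b0 : pdot b b <= 0 by apply: imp.
  have b1 := dotp_ge0 b.1; have b2 : 0 <= b.2 * b.2 by rewrite -expr2 sqr_ge0.
  have E1 : dotp b.1 b.1 = 0 by move: b0; rewrite /pdot; lra.
  have E2 : b.2 * b.2 = 0 by move: b0; rewrite /pdot; lra.
  move/eqP: E2; rewrite mulf_eq0 orbb => /eqP E2.
  by rewrite [b]surjective_pairing E2 (dotp_eq0 E1).
have subs : [set` s] `<=` [set` a :: s] by move=> x /= xs; rewrite inE xs orbT.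
have [imps|/existsNP[q0 /not_implyP[q0s /negP]]] := pselect (forall q : V,
    (forall c, c \in s -> pdot c q <= 0) -> pdot b q <= 0).
  by apply: conic_hull_sub subs _ _; exact: IH.
rewrite -ltNge => bq0.
have aq0 : 0 < pdot a q0.
  rewrite ltNge; apply/negP => aq0; move: bq0; rewrite ltNge imp // => c.
  by rewrite inE => /predU1P[->|/q0s].
pose q := (pdot a q0)^-1 *: q0.
have aq : pdot a q = 1 by rewrite /q pdotZr mulVf // gt_eqF.
have bq : 0 < pdot b q by rewrite /q pdotZr mulr_gt0 // invr_gt0.
have qs c : c \in s -> pdot c q <= 0.
  by move=> /q0s cq; rewrite /q pdotZr mulr_ge0_le0 // invr_ge0 ltW.
clearbody q.
(* The projected functionals do not change when [x] is moved along [q]; moving it until [a] vanishes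
   makes the hypothesis for the full list applicable. *)
have proj x : (forall c, c \in [seq c - pdot c q *: a | c <- s] -> pdot c x <= 0) ->
    pdot (b - pdot b q *: a) x <= 0.
  move=> xs.
  have projE c : pdot (c - pdot c q *: a) x = pdot c (x - pdot a x *: q).
    by rewrite pdotBl pdotZl pdotBr pdotZr mulrC.
  rewrite projE; apply: imp => c; rewrite inE => /predU1P[->|cs].
    by rewrite pdotBr pdotZr aq mulr1 subrr.
  by rewrite -projE xs // (map_f (fun c => c - pdot c q *: a)).
(* A combination of projected functionals is the projection of the same combination [u] of the
   original ones. *)
have lift v : conic_hull [set` [seq c - pdot c q *: a | c <- s]] v ->
    exists u, [/\ conic_hull [set` s] u, pdot u q <= 0 & v = u - pdot u q *: a].
  elim=> [|t _ w /= /mapP[c cs ->] t0 _ [u [hu uq ->]]].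
    exists 0; split; [by constructor| |].
      by rewrite -(scale0r q) pdotZl mul0r.
    by rewrite -[X in pdot X q](scale0r q) pdotZl mul0r scale0r subrr.
  exists (t *: c + u); split.
  - exact: conic_hull_cons.
  - by rewrite pdotDl pdotZl -[leRHS]addr0 lerD // mulr_ge0_le0 // qs.
  - by rewrite pdotDl pdotZl scalerBr scalerA [X in _ = _ - X]scalerDl opprD addrACA.
have [|u [hu uq /eqP]] := lift _ (IH _ _ _ proj); first by rewrite size_map.
rewrite subr_eq => /eqP ->.
(* The multiplier of [a] is nonnegative because [pdot u q <= 0 < pdot b q]. *)
rewrite -addrA addrC; have -> : - (pdot u q *: a) + pdot b q *: a + u = (pdot b q - pdot u q) *: a + u.
  by rewrite scalerBl [- _ + _]addrC.
apply: conic_hull_cons; rewrite /= ?mem_head //; first by lra.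
exact: conic_hull_sub subs _ hu.
Qed.

Lemma fst_sum (I : Type) (r : seq I) (P : pred I) (F : I -> V) :
  (\sum_(i <- r | P i) F i).1 = \sum_(i <- r | P i) (F i).1.
Proof. by elim/big_rec2: _ => // i x y _ <-. Qed.

Lemma snd_sum (I : Type) (r : seq I) (P : pred I) (F : I -> V) :
  (\sum_(i <- r | P i) F i).2 = \sum_(i <- r | P i) (F i).2.
Proof. by elim/big_rec2: _ => // i x y _ <-. Qed.

Lemma conic_hull_family (W : lmodType R) (I : finType) (g : I -> W) v :
  conic_hull [set` [seq g i | i : I]] v ->
  exists2 t : I -> R, (forall i, 0 <= t i) & v = \sum_i t i *: g i.
Proof.
elim=> [|t _ w /= /mapP[i _ ->] t0 _ [r r0 ->]].
  by exists (fun=> 0) => //; rewrite big1 // => i _; rewrite scale0r.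
exists (fun j => (if j == i then t else 0) + r j).
  by move=> j; rewrite addr_ge0 //; case: ifP.
under [RHS]eq_bigr do rewrite scalerDl.
rewrite big_split /=; congr (_ + _).
rewrite (bigD1 i) //= eqxx big1 ?addr0 // => j /negPf ->.
by rewrite scale0r.
Qed.

Lemma farkas_family (I : finType) (a : I -> V) (b : V) :
  (forall q, (forall i, pdot (a i) q <= 0) -> pdot b q <= 0) ->
  exists2 t : I -> R, (forall i, 0 <= t i) & b = \sum_i t i *: a i.
Proof.
move=> imp; apply: conic_hull_family; apply: farkas => q aq; apply: imp => i.
by apply: aq; rewrite map_f // mem_enum.
Qed.

(** Homogenize with a coordinate [r], the functional [(0, -1)] standing for [0 <= r]. Pairs with
    positive [r] rescale to points of the polyhedron; those with [r = 0] are recession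
    directions. *)
Lemma affine_farkas k (G : 'M[R]_(k, n)) (h : 'rV[R]_k) (y : 'rV[R]_n) (tau : R) :
  [set x | forall j, dotp (row j G) x <= h 0 j] !=set0 ->
  (forall x, (forall j, dotp (row j G) x <= h 0 j) -> dotp y x <= tau) ->
  exists mu : 'rV[R]_k, [/\ forall j, 0 <= mu 0 j, y = mu *m G & dotp mu h <= tau].
Proof.
move=> [x0 /= x0X] imp.
have [] := @farkas_family ('I_k + unit)%type
  (fun i => match i with inl j => (row j G, - h 0 j) | inr _ => (0, -1) end)
  (y, - tau).
  move=> [x r] ineq.
  have r0 : 0 <= r by have := ineq (inr tt); rewrite /pdot /= dotp0l; lra.
  have Gx j : dotp (row j G) x <= h 0 j * r.
    by have := ineq (inl j); rewrite /pdot /=; lra.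
  rewrite /pdot /=; have [r1|rle] := ltP 0 r.
    have := imp (r^-1 *: x); rewrite dotpZr mulrC ler_pdivrMr // => yx.
    suff : dotp y x <= tau * r by lra.
    by apply: yx => j; rewrite dotpZr mulrC ler_pdivrMr.
  have {}r0 : r = 0 by apply/eqP; rewrite eq_le rle r0.
  subst r; rewrite mulr0 addr0 leNgt; apply/negP => yx.
  (* Moving this far from [x0] along the recession direction [x] raises [dotp y] above [tau]. *)
  pose s := (`|tau - dotp y x0| + 1) / dotp y x.
  have s0 : 0 <= s by rewrite divr_ge0 ?ltW // addr_ge0.
  have := imp (x0 + s *: x); rewrite dotpDr dotpZr /s divfK ?gt_eqF // => ytau.
  have : dotp y x0 + (`|tau - dotp y x0| + 1) <= tau.
    apply: ytau => j; rewrite dotpDr dotpZr -[leRHS]addr0 lerD //.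
    by rewrite mulr_ge0_le0 //; have := Gx j; rewrite mulr0.
  by have := ler_norm (tau - dotp y x0); lra.
move=> t t0; rewrite big_sumType /= => E.
exists (\row_j t (inl j)); split.
- by move=> j; rewrite mxE.
- move/(congr1 fst): E; rewrite /= !fst_sum /= [X in _ + X]big1 ?addr0.
    by move=> ->; rewrite mulmx_sum_row; apply: eq_bigr => j _; rewrite mxE.
  by move=> i _; rewrite scaler0.
- move/(congr1 snd): E; rewrite /= !snd_sum /= => E.
  suff : - tau <= - dotp (\row_j t (inl j)) h by rewrite lerN2.
  rewrite E /dotp -sumrN -[leRHS]addr0 lerD //.
    by apply: ler_sum => j _; rewrite mxE -mulrN; exact: lexx.
  by apply: sumr_le0 => i _; rewrite mulr_ge0_le0.
Qed.

End Farkas.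

(** * Circuits and extreme rays *)

Section CircuitCones.
Variables (R : realType) (n m : nat) (X : set 'rV[R]_n) (A : 'M[R]_(m, n)).
Hypothesis X0 : X !=set0.
Let W := ('rV[R]_m * R^o)%type.
Implicit Types (nu lam : 'rV[R]_m) (p : W) (x : 'rV[R]_n) (t : R).

(** The height of [p] above the linear minorant of [nu |-> sigma_X (- A nu)] given by the point
    [x]. *)
Definition slack p x : R := dotp (p.1 *m A) x + p.2.

(* The epigraph of [nu |-> sigma_X (- A nu)] over [N_b]. *)
Definition econe (b : 'I_m) : set W :=
  [set p | Nset b p.1 /\ forall x, X x -> 0 <= slack p x].

Lemma slackD p q x : slack (p + q) x = slack p x + slack q x.
Proof. by rewrite /slack /= mulmxDl dotpDl addrACA. Qed.

Lemma slackZ t p x : slack (t *: p) x = t * slack p x.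
Proof. by rewrite /slack /= -scalemxAl dotpZl mulrDr. Qed.

Lemma sigA_leP nu t :
  (sigA X A nu <= t%:E)%E <-> forall x, X x -> 0 <= slack (nu, t) x.
Proof.
split=> [le x Xx|le].
  have : ((dotp (- (nu *m A)) x)%:E <= t%:E)%E.
    by apply: le_trans le; apply: ereal_sup_ubound; exists x.
  by rewrite lee_fin dotpNl /slack /=; lra.
apply: ge_ereal_sup => _ [x Xx <-]; have := le _ Xx.
by rewrite lee_fin dotpNl /slack /=; lra.
Qed.

Lemma sigA_fin_num nu : (sigA X A nu < +oo)%E -> sigA X A nu \is a fin_num.
Proof.
move=> lt; rewrite fin_numElt lt andbT; have [x Xx] := X0.
apply: (@lt_le_trans _ _ (dotp (- (nu *m A)) x)%:E); first exact: ltNyr.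
by apply: ereal_sup_ubound; exists x.
Qed.

Lemma phi_slack_ge0 nu x : (sigA X A nu < +oo)%E -> X x -> 0 <= slack (phi X A nu) x.
Proof.
by move=> /sigA_fin_num fin; apply: (sigA_leP nu _).1; rewrite fineK.
Qed.

Lemma sigA_lty nu t : (forall x, X x -> 0 <= slack (nu, t) x) -> (sigA X A nu < +oo)%E.
Proof. by move=> /sigA_leP le; apply: le_lt_trans le _; exact: ltry. Qed.

Lemma fine_sigA_le nu t :
  (forall x, X x -> 0 <= slack (nu, t) x) -> fine (sigA X A nu) <= t.
Proof.
move=> ge0; rewrite -lee_fin fineK; first exact/sigA_leP.
exact: sigA_fin_num (sigA_lty ge0).
Qed.

Lemma phiZ t nu : 0 < t -> (sigA X A nu < +oo)%E ->
  (sigA X A (t *: nu) < +oo)%E /\ phi X A (t *: nu) = t *: (phi X A nu : W).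
Proof.
move=> t0 fin.
have ge0 x : X x -> 0 <= slack (t *: nu, t * fine (sigA X A nu)) x.
  move=> Xx; have := slackZ t (phi X A nu) x.
  rewrite /slack /= => ->; rewrite mulr_ge0 ?(ltW t0) //.
  exact: (phi_slack_ge0 fin Xx).
have fint := sigA_lty ge0; split => //.
congr (_, _); apply/eqP; rewrite eq_le (fine_sigA_le ge0) /=.
rewrite -[X in _ <= X](mulVKf (lt0r_neq0 t0)) ler_pM2l //.
apply: fine_sigA_le => x Xx; have := phi_slack_ge0 fint Xx.
rewrite /slack /= -scalemxAl dotpZl => le.
by rewrite -(pmulr_rge0 _ t0) mulrDr mulVKf ?lt0r_neq0.
Qed.

Lemma NsetD b nu lam : Nset b nu -> Nset b lam -> Nset b (nu + lam).
Proof.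
move=> [nu0 nuS] [l0 lS]; split=> [a ab|].
  by rewrite mxE addr_ge0 ?nu0 ?l0.
by under eq_bigr do rewrite mxE; rewrite big_split /= nuS lS addr0.
Qed.

Lemma NsetZ b t nu : 0 <= t -> Nset b nu -> Nset b (t *: nu).
Proof.
move=> t0 [nu0 nuS]; split=> [a ab|]; first by rewrite mxE mulr_ge0 // nu0.
by under eq_bigr do rewrite mxE; rewrite -mulr_sumr nuS mulr0.
Qed.

Lemma Nset0 b : Nset b (0 : 'rV[R]_m).
Proof. by split=> [a _|]; [rewrite mxE|rewrite big1 // => a _; rewrite mxE]. Qed.

Lemma Nset_eq0 b nu : \sum_a nu 0 a = 0 -> (forall a, a != b -> nu 0 a = 0) -> nu = 0.
Proof.
move=> nuS nu0; apply/rowP => a; rewrite mxE; have [->|/nu0//] := eqVneq a b.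
by move: nuS; rewrite (bigD1 b) //= big1 ?addr0 // => i /nu0.
Qed.

Lemma Nset_lt0 b nu : Nset b nu -> nu != 0 -> nu 0 b < 0.
Proof.
move=> [nu0 nuS] nz; rewrite ltNge; apply: contraNN nz => nub; apply/eqP.
apply: (Nset_eq0 (b := b) nuS) => a ab.
by rewrite (psumr_eq0P _ nuS) // => i _; have [->|/nu0] := eqVneq i b.
Qed.

Lemma econeD b p q : econe b p -> econe b q -> econe b (p + q).
Proof.
move=> [Np p0] [Nq q0]; split; first exact: NsetD.
by move=> x Xx; rewrite slackD addr_ge0 ?p0 ?q0.
Qed.

Lemma econeZ b t p : 0 <= t -> econe b p -> econe b (t *: p).
Proof.
move=> t0 [Np p0]; split; first exact: NsetZ.
by move=> x Xx; rewrite slackZ mulr_ge0 ?p0.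
Qed.

Lemma slack_vertical t x : slack (0, t) x = t.
Proof. by rewrite /slack /= mul0mx dotp0l add0r. Qed.

Lemma econe_vertical b t : 0 <= t -> econe b (0, t).
Proof.
by move=> t0; split; [exact: Nset0|move=> x _; rewrite slack_vertical].
Qed.

(** Opposite vectors of [N_b] vanish off [b], hence also at [b] by the zero sum; the slack then
    forces the height to be 0. *)
Lemma econe_pointed b : pointed (econe b).
Proof.
move=> [nu t] [[/= N1 N2] p0] [[/= M1 M2] q0].
have nu0 : nu = 0.
  apply: (Nset_eq0 (b := b) N2) => a ab; apply/eqP; rewrite eq_le N1 // andbT.
  by have := M1 _ ab; rewrite mxE; lra.
have [x Xx] := X0; move: (p0 x Xx) (q0 x Xx).
rewrite -scaleN1r slackZ nu0 slack_vertical mulN1r oppr_ge0 => t0 t1.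
by congr (_, _); apply/eqP; rewrite eq_le t0 t1.
Qed.

Lemma Lambda_econe lam : Lambda X A lam ->
  exists b, [/\ Nset b lam, lam 0 b = -1, (sigA X A lam < +oo)%E &
                econe b (phi X A lam)].
Proof.
move=> [b [[N _ fin _] lamb]]; exists b; split=> //; split=> // x Xx.
exact: phi_slack_ge0.
Qed.

Lemma extremal_scale (V : lmodType R) (K : set V) t v :
  0 < t -> K (t *: v) -> extremal K v -> extremal K (t *: v).
Proof.
move=> t0 Ktv [v0 Kv ext]; split=> //; first by rewrite scaler_eq0 gt_eqF.
move=> u w Ku Kw [r r0 uw]; have [] := ext u w Ku Kw.
  by exists (r * t); [rewrite mulr_ge0 // ltW|rewrite uw scalerA].
by move=> [a a0 ->] [c c0 ->]; split; [exists (a / t)|exists (c / t)];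
  rewrite ?divr_ge0 ?(ltW t0) // scalerA divfK ?gt_eqF.
Qed.

(** If the first component is nonzero, extremality forces the height to be the support value, and a
    segment violating the circuit condition would split the ray. *)
Lemma econe_extremal b p : extremal (econe b) p ->
  (exists2 t, 0 < t & p = t *: (0, 1)) \/
  exists lam, Lambda X A lam /\ exists2 t, 0 < t & p = t *: (phi X A lam : W).
Proof.
move: p => [nu tau] ext; have [p0 [Np pX] pext] := ext.
have fin := sigA_lty pX; have sle := fine_sigA_le pX.
have [nu0|nun0] := eqVneq nu 0.
  left; subst nu; have [x Xx] := X0; have := pX x Xx; rewrite slack_vertical => t0.
  exists tau; last by congr (_, _); rewrite /= ?scaler0 // [_ *: _]mulr1.
  by rewrite lt_neqAle t0 andbT eq_sym; apply: contraNneq p0 => ->.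
right; have b0 := Nset_lt0 Np nun0.
(* Any excess height splits off as a vertical summand, which cannot lie on a ray with nonzero first
   component. *)
have tauE : tau = fine (sigA X A nu).
  have [|||_ [r r0 [/esym/eqP]]] := pext (phi X A nu) (0, tau - fine (sigA X A nu)).
  - by split=> // x Xx; exact: phi_slack_ge0.
  - by apply: econe_vertical; rewrite subr_ge0.
  - by exists 1 => //; rewrite scale1r; congr (_, _); rewrite /= ?addr0 // addrC subrK.
  rewrite scaler_eq0 (negPf nun0) orbF => /eqP -> /eqP.
  by rewrite [0 *: _]mul0r subr_eq0 => /eqP.
pose t := - nu 0 b; have t0 : 0 < t by rewrite oppr_gt0.
pose lam := t^-1 *: nu.
have [fl phil] : (sigA X A lam < +oo)%E /\ phi X A lam = t^-1 *: (phi X A nu : W).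
  by apply: phiZ => //; rewrite invr_gt0.
have pE : (nu, tau) = t *: (phi X A lam : W).
  by rewrite phil scalerA divff ?gt_eqF // scale1r tauE.
exists lam; split; last by exists t.
exists b; split; last by rewrite mxE /t invrN mulNr mulVf // lt_eqF.
have Nl : Nset b lam by apply: NsetZ => //; rewrite invr_ge0 ltW.
have exl : extremal (econe b) (phi X A lam).
  rewrite phil -[phi X A nu]/(nu, fine (sigA X A nu)) -tauE.
  apply: extremal_scale => //; first by rewrite invr_gt0.
  by apply: econeZ => //; rewrite invr_ge0 ltW.
have [_ _ {}pext] := exl.
split=> //; first by rewrite scaler_eq0 invr_eq0 negb_or nun0 gt_eqF.
move=> [nu1 [nu2 [th [[N1 N2] /andP[th0 th1] lE npr [f1 [f2 aff]]]]]].
have sg : forall nu', sigA X A nu' \is a fin_num -> Nset b nu' -> econe b (phi X A nu').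
  move=> nu' fn N'; split=> // x Xx; apply: phi_slack_ge0 => //.
  by move: fn; rewrite fin_numElt => /andP[].
(* Affinity makes the two heights add up to that of [phi lam], so extremality turns [nu1] and [nu2]
   into multiples of [lam]. *)
have [|||[r r0 [E1 _]] [s s0 [E2 _]]] := pext
    ((1 - th) *: (phi X A nu1 : W)) (th *: (phi X A nu2 : W)).
- by apply: econeZ; [lra|exact: sg].
- by apply: econeZ; [lra|exact: sg].
- exists 1 => //; rewrite scale1r; congr (_, _); first by rewrite lE.
  rewrite lE /= aff ?(ltW th0) ?(ltW th1) //.
  by rewrite -(fineK f1) -(fineK f2) -!EFinM -EFinD.
apply: npr.
have nu1E : nu1 = ((1 - th)^-1 * r) *: lam.
  by rewrite -scalerA -E1 scalerA mulVf ?scale1r // gt_eqF // subr_gt0.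
have nu2E : nu2 = (th^-1 * s) *: lam.
  by rewrite -scalerA -E2 scalerA mulVf ?scale1r // gt_eqF.
have [z|nz] := eqVneq (th^-1 * s) 0.
  by exists 0; right; rewrite nu2E z !scale0r.
by exists ((1 - th)^-1 * r / (th^-1 * s)); left; rewrite nu2E scalerA divfK.
Qed.

End CircuitCones.

(** * The circuit graph and its pointedness *)

Section CircuitGraph.
Variables (R : realType) (n m : nat) (X : set 'rV[R]_n) (A : 'M[R]_(m, n)).
Hypothesis X0 : X !=set0.
Let W := ('rV[R]_m * R^o)%type.
Implicit Types (nu lam : 'rV[R]_m) (p : W) (x : 'rV[R]_n) (t : R).

(** The parameter [L] allows comparing all circuits, the reduced ones, and the reduced ones with
    some left out. *)
Definition ray_generators (L : set 'rV[R]_m) : set W :=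
  [set p | (exists2 lam, L lam & p = phi X A lam) \/ p = (0, 1)].

Local Notation graph := (conic_hull (ray_generators (Lambda X A))).

Lemma circuit_graphE : circuit_graph X A = graph.
Proof.
apply/seteqP; split.
  move=> [nu tau] [k [t [l [t0 [tl t00 /= -> ->]]]]].
  have -> : (\sum_(i < k) t i *: l i, \sum_(i < k) t i * fine (sigA X A (l i)) + t0) =
      \sum_(i < k) t i *: (phi X A (l i) : W) + t0 *: ((0, 1) : W).
    rewrite [RHS]surjective_pairing /= fst_sum snd_sum /= scaler0 addr0.
    by congr (_, _ + _); rewrite [RHS]mulr1.
  apply: conic_hullD; last first.
    by apply: conic_hullZ => //; apply: sub_conic_hull; right.
  elim/big_rec: _ => [|i v _ hv]; first by constructor.
  have [ti li] := tl i; apply: conic_hull_cons => //.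
  by left; exists (l i).
move=> p; elim=> [|t s v Ss t0 _ [k [r [l [r0 [rl r00 E1 E2]]]]]].
  exists 0%N, (fun=> 0), (fun=> 0), 0; split=> //; first by case.
    by rewrite big_ord0.
  by rewrite big_ord0 addr0.
case: Ss => [[lam Llam ->]|->].
  exists k.+1, (fun i => if unlift ord0 i is Some j then r j else t),
    (fun i => if unlift ord0 i is Some j then l j else lam), r0; split=> //.
  - by move=> i; case: unliftP => [j|] _.
  - rewrite big_ord_recl unlift_none /= E1; congr (_ + _).
    by apply: eq_bigr => j _; rewrite liftK.
  - rewrite big_ord_recl unlift_none /= E2 -addrA; congr (_ + (_ + _)).
    by apply: eq_bigr => j _; rewrite liftK.
exists k, r, l, (t + r0); split=> //; first exact: addr_ge0.
  by rewrite /= scaler0 add0r.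
by rewrite /= [_ *: _]mulr1 E2 addrCA.
Qed.

Lemma extreme_rayE (K : set W) p : extreme_ray K p <-> extremal K p.
Proof.
have rayE (u v : W) : on_ray u v <-> ray u v.
  split=> [[s [s0 e1 e2]]|[s s0 ->]]; last by exists s.
  by exists s => //; rewrite [v]surjective_pairing e1 e2.
have nz : p.1 != 0 \/ p.2 != 0 <-> p != 0.
  split=> [[]|]; [by apply: contraNneq => ->|by apply: contraNneq => ->|].
  case: p => nu t; have [->|] := eqVneq nu 0; last by left.
  by move=> tn; right; apply: contraNneq tn => /= ->.
split=> -[/nz p0 Kp ext]; split=> //; move=> u w Ku Kw /rayE /ext.
  by case=> // /rayE ? /rayE ?.
by case=> // ? ?; split; exact/rayE.
Qed.

Lemma Lambda_starE lam :
  Lambda_star X A lam <-> Lambda X A lam /\ extremal graph (phi X A lam).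
Proof.
by rewrite -circuit_graphE; split=> -[L /extreme_rayE].
Qed.

Lemma Lambda_neq0 lam : Lambda X A lam -> lam != 0.
Proof. by move=> [b [[]]]. Qed.

(** The only negative entry of a normalized circuit is [-1], which fixes both its position and the
    scale. *)
Lemma Lambda_ray_inj lam lam' r : Lambda X A lam -> Lambda X A lam' ->
  0 < r -> lam' = r *: lam -> lam' = lam.
Proof.
move=> /Lambda_econe[//|b [Nl lb _ _]] /Lambda_econe[//|b' [[Nl' _] lb' _ _]] r0 E.
have [bb|bb] := eqVneq b b'.
  move: lb'; rewrite E -bb mxE lb mulrN1 => /oppr_inj ->.
  by rewrite scale1r.
by have := Nl' _ bb; rewrite E mxE lb mulrN1 oppr_ge0 leNgt r0.
Qed.

Lemma graph_slack_ge0 p x : X x -> graph p -> 0 <= slack A p x.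
Proof.
move=> Xx; elim=> [|t s v Ss t0 _ IH]; first by rewrite slack_vertical.
rewrite slackD slackZ addr_ge0 // mulr_ge0 //.
case: Ss => [[lam /Lambda_econe[//|b [_ _ fin _]] ->]|->].
  exact: phi_slack_ge0.
by rewrite slack_vertical.
Qed.

(** If [alpha_a - alpha_b] had a constant value [k] on [X], the exponential of [alpha_a] would be
    [expR k] times that of [alpha_b] there, a linear dependence. *)
Lemma separating_difference a b : exp_lin_indep X A -> a != b ->
  exists d, (exists x y, [/\ X x, X y & d = x - y]) /\
    dotp (row a A) d - dotp (row b A) d != 0.
Proof.
move=> indep ab; apply: contrapT => /forallNP nd; have [x0 Xx0] := X0.
pose k := dotp (row a A) x0 - dotp (row b A) x0.
have kE x : X x -> dotp (row a A) x = dotp (row b A) x + k.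
  move=> Xx; have /not_andP[[]|/negP] := nd (x - x0); first by exists x, x0.
  by rewrite negbK !dotpBr => /eqP; rewrite /k; lra.
pose c : 'rV[R]_m := \row_i ((i == a)%:R - (i == b)%:R * expR k).
suff /rowP/(_ a) : c = 0.
  by rewrite !mxE eqxx (negPf ab) mul0r subr0 => /eqP; rewrite oner_eq0.
apply: indep => x Xx; rewrite /signomial (bigD1 a) //= (bigD1 b) 1?eq_sym //=.
rewrite big1 => [|i /andP[/negPf ia /negPf ib]]; last first.
  by rewrite mxE ia ib mul0r subrr mul0r.
rewrite !mxE !eqxx (negPf ab) eq_sym (negPf ab) mul0r subr0 !mul1r kE // expRD.
by rewrite addr0 sub0r mulNr mulrC subrr.
Qed.

(* For a circuit [lam] with [sum_i lam_i alpha_i d = 0], the quadratic functional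
   [sum_i lam_i (alpha_i d)^2] is a variance, hence nonnegative. *)
Lemma quadratic_ge0 b lam (d : 'rV[R]_n) : Nset b lam -> dotp (lam *m A) d = 0 ->
  \sum_i lam 0 i * dotp (row i A) d ^+ 2 =
  \sum_i lam 0 i * (dotp (row i A) d - dotp (row b A) d) ^+ 2 /\
  forall i, 0 <= lam 0 i * (dotp (row i A) d - dotp (row b A) d) ^+ 2.
Proof.
move=> [N1 N2] lamd; split=> [|i]; last first.
  have [->|ib] := eqVneq i b; first by rewrite subrr expr0n mulr0.
  by rewrite mulr_ge0 ?N1 // sqr_ge0.
move: (dotp (row b A) d) => s.
have -> : \sum_i lam 0 i * (dotp (row i A) d - s) ^+ 2 =
    \sum_i lam 0 i * dotp (row i A) d ^+ 2
      - 2 * s * (\sum_i lam 0 i * dotp (row i A) d) + s ^+ 2 * \sum_i lam 0 i.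
  rewrite !mulr_sumr -sumrB -big_split /=; apply: eq_bigr => i _.
  by ring.
by rewrite -dotp_mulmx lamd N2; ring.
Qed.

(** If [p] and [- p] lie in the graph, both have zero slack on all of [X], so only circuits tight on
    [X] enter them. The linear functional [Q] is positive on such circuits, and cannot be positive
    at both [p] and [- p]. *)
Lemma graph_pointed : exp_lin_indep X A -> pointed graph.
Proof.
move=> indep.
have /choice[D DP] : forall ab : 'I_m * 'I_m, exists d : 'rV[R]_n,
    ab.1 != ab.2 -> (exists x y, [/\ X x, X y & d = x - y]) /\
    dotp (row ab.1 A) d - dotp (row ab.2 A) d != 0.
  move=> [a b] /=; have [->|ab] := eqVneq a b; first by exists 0.
  by have [d dP] := separating_difference indep ab; exists d.
(* Using one separating direction per pair of exponents makes a single functional serve all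
   circuits: if [b] is the negative index and [a] another nonzero entry, the pair [(a, b)]
   contributes strictly. *)
pose Q nu := \sum_(ab : 'I_m * 'I_m | ab.1 != ab.2)
  \sum_i nu 0 i * dotp (row i A) (D ab) ^+ 2.
have QD t nu lam : Q (t *: nu + lam) = t * Q nu + Q lam.
  rewrite /Q mulr_sumr -big_split; apply: eq_bigr => ab _ /=.
  rewrite mulr_sumr -big_split; apply: eq_bigr => i _ /=.
  by rewrite !mxE; ring.
have Q0 : Q 0 = 0.
  by rewrite /Q big1 // => ab _; rewrite big1 // => i _; rewrite mxE mul0r.
have QN nu : Q (- nu) = - Q nu.
  by rewrite -[- nu]addr0 -scaleN1r QD Q0 addr0 mulN1r.
have Qgt0 lam : Lambda X A lam -> (forall x, X x -> slack A (phi X A lam) x = 0) ->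
    0 < Q lam.
  move=> /[dup] /Lambda_neq0 ln0 /Lambda_econe[//|b [Nl lb _ _]] tight.
  have lamD ab : ab.1 != ab.2 -> dotp (lam *m A) (D ab) = 0.
    move=> /DP[[x [y [Xx Xy ->]]] _]; rewrite dotpBr.
    by have := tight x Xx; have := tight y Xy; rewrite /slack /=; lra.
  have [a [ab la]] : exists a, a != b /\ lam 0 a != 0.
    apply: contrapT => /forallNP na; move/eqP: ln0; apply.
    apply: (Nset_eq0 (b := b)); first by case: Nl.
    by move=> a ab; apply/eqP/negPn/negP => la; apply: (na a).
  rewrite /Q (bigD1 (a, b)) //= ltr_wpDr //.
    apply: sumr_ge0 => cd /andP[cdn _].
    have [-> ge0] := quadratic_ge0 Nl (lamD cd cdn).
    by apply: sumr_ge0 => i _.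
  have [-> ge0] := quadratic_ge0 Nl (lamD (a, b) ab).
  rewrite (bigD1 a) //= ltr_wpDr //; first by apply: sumr_ge0 => i _.
  rewrite lt_neqAle ge0 andbT eq_sym mulf_neq0 // sqrf_eq0.
  by have [] := DP (a, b) ab.
have tightQ p : graph p -> (forall x, X x -> slack A p x = 0) -> p = 0 \/ 0 < Q p.1.
  elim=> [|t s v Ss t0 gv IH tight]; first by left.
  have gs : graph s by exact: sub_conic_hull.
  have tights x : X x -> t * slack A s x = 0 /\ slack A v x = 0.
    move=> Xx; have := tight x Xx; rewrite slackD slackZ.
    have v0 := graph_slack_ge0 Xx gv.
    have s0 : 0 <= t * slack A s x by rewrite mulr_ge0 // graph_slack_ge0.
    by split; lra.
  have [->|tn0] := eqVneq t 0.
    by rewrite scale0r add0r; apply: IH => x /tights[].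
  have tv x : X x -> slack A v x = 0 by move=> /tights[].
  have ts x : X x -> slack A s x = 0.
    by move=> /tights[/eqP]; rewrite mulf_eq0 (negPf tn0) => /eqP.
  case: Ss ts {gs tights tight} => [[lam Ll ->]|->] ts; last first.
    have [x Xx] := X0; have /eqP := ts x Xx.
    by rewrite slack_vertical oner_eq0.
  have Ql := Qgt0 _ Ll ts; right; rewrite /= QD.
  have tp : 0 < t * Q lam by rewrite mulr_gt0 // lt_neqAle eq_sym tn0.
  by rewrite ltr_wpDr //; case: IH => [//|->|/ltW //]; rewrite Q0.
move=> p gp gNp.
have tight x : X x -> slack A p x = 0.
  move=> Xx; have := graph_slack_ge0 Xx gp; have := graph_slack_ge0 Xx gNp.
  by rewrite -scaleN1r slackZ; lra.
have [//|Q1] := tightQ p gp tight.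
have [|/eqP|Q2] := tightQ (- p) gNp.
- by move=> x Xx; rewrite -scaleN1r slackZ tight // mulr0.
- by rewrite oppr_eq0 => /eqP.
by move: Q2; rewrite /= QN oppr_gt0 ltNge (ltW Q1).
Qed.

End CircuitGraph.

(** * Finite generation of the circuit graph and its reduced circuits *)

Section ReducedCircuits.
Variables (R : realType) (n m : nat) (X : set 'rV[R]_n) (A : 'M[R]_(m, n)).
Hypotheses (X0 : X !=set0) (polyX : polyhedron X).
Let W := ('rV[R]_m * R^o)%type.
Implicit Types (nu lam : 'rV[R]_m) (p : W) (x : 'rV[R]_n) (t : R).

Local Notation graph := (conic_hull (ray_generators X A (Lambda X A))).

(* [econe b] is the projection of the pointed polyhedral cone of all
   [(nu, tau, mu)] with [mu >= 0], [A nu + G mu = 0] and [h mu <= tau], where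
   [X = {x | G x <= h}]. *)
Lemma econe_finite b : exists s : seq W, econe X A b = conic_hull [set` s].
Proof.
have [k [G [h XE]]] := polyX.
pose U := (W * 'rV[R]_k)%type.
(* The form at [b] is zero because the sign of [nu 0 b] is unconstrained. *)
pose f (i : 'I_m + ('I_k + unit)) (u : U) : R :=
  match i with
  | inl a => if a == b then 0 else u.1.1 0 a
  | inr (inl j) => u.2 0 j
  | inr (inr _) => u.1.2 - dotp u.2 h
  end.
pose P := [set u : U | \sum_a u.1.1 0 a = 0 /\ u.1.1 *m A + u.2 *m G = 0].
have [||||s sE] := @polyhedral_cone_finite_hull R U _ f P.
- case=> [a|[j|_]] t u v /=; rewrite ?mxE //.
    by case: eqP => _; rewrite ?mxE ?mulr0 ?addr0.
  by rewrite dotpDl dotpZl mulrBr opprD addrACA.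
- split; last by rewrite /= !mul0mx addr0.
  by rewrite big1 // => a _; rewrite mxE.
- move=> t u v [u1 u2] [v1 v2]; split=> /=.
    under eq_bigr do rewrite !mxE.
    by rewrite big_split -mulr_sumr /= u1 v1 mulr0 addr0.
  rewrite !mulmxDl -!scalemxAl addrACA -scalerDr.
  by rewrite u2 v2 scaler0 addr0.
- move=> [[nu tau] mu] [/= nuS _] f0.
  have nu0 : nu = 0.
    apply: (Nset_eq0 (b := b) nuS) => a /negPf ab.
    by have := f0 (inl a); rewrite /= ab.
  have mu0 : mu = 0 by apply/rowP => j; rewrite mxE; exact: (f0 (inr (inl j))).
  have := f0 (inr (inr tt)); rewrite /= mu0 dotp0l subr0 => ->.
  by rewrite nu0.
exists [seq u.1 | u <- s].
have -> : [set` [seq u.1 | u <- s]] = fst @` [set` s].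
  apply/seteqP; split=> [p /mapP[u us ->]|_ [u us <-]]; first by exists u.
  exact: map_f.
rewrite (conic_hull_image (fst : {linear U -> W})) -sE; apply/seteqP; split.
  move=> [nu tau] [[N1 N2] p0]; have := X0; rewrite XE => X0'.
  have [|mu [mu0 E le]] := @affine_farkas _ _ _ G h (- (nu *m A)) tau X0'.
    move=> x Xx; have : 0 <= slack A (nu, tau) x by apply: p0; rewrite XE.
    by rewrite /slack /= dotpNl; lra.
  exists ((nu, tau), mu) => //; split; first by split; rewrite //= -E subrr.
  case=> [a|[j|_]] //=; last by rewrite subr_ge0.
  by case: ifPn => // /N1.
move=> _ [[[nu tau] mu] [[/= nuS eq0] ge0] <-]; split=> /=.
  split=> // a /negPf ab.
  by have := ge0 (inl a); rewrite /= ab.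
move=> x; rewrite XE /= => Xx.
move/eqP: eq0; rewrite addr_eq0 => /eqP nuA.
have := ge0 (inr (inr tt)); rewrite /slack /= nuA dotpNl dotp_mulmx.
suff : \sum_j mu 0 j * dotp (row j G) x <= dotp mu h by lra.
apply: ler_sum => j _; rewrite ler_wpM2l //.
exact: (ge0 (inr (inl j))).
Qed.

Lemma econe_sub_graph b : econe X A b `<=` graph.
Proof.
have [s0 s0E] := econe_finite b.
have [s [sE ext]] := pointed_hull_extremal_generators s0E (econe_pointed X0 (b := b)).
rewrite sE; apply: conic_hull_min => p /ext /(econe_extremal X0).
move=> [[t t0 ->]|[lam [Llam [t t0 ->]]]]; apply: conic_hullZ; rewrite ?ltW //.
  by apply: sub_conic_hull; right.
by apply: sub_conic_hull; left; exists lam.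
Qed.

Hypotheses (m0 : (0 < m)%N) (indep : exp_lin_indep X A).

Lemma graph_finite : exists s : seq W, graph = conic_hull [set` s].
Proof.
have /choice[s sE] := econe_finite.
exists (flatten [seq s b | b <- enum 'I_m]).
have sub b : econe X A b `<=` conic_hull [set` flatten [seq s b | b <- enum 'I_m]].
  rewrite sE; apply: conic_hull_sub => v /= vs.
  by apply/flatten_mapP; exists b => //; rewrite mem_enum.
apply/seteqP; split; apply: conic_hull_min.
  move=> p [[lam /(Lambda_econe X0)[b [_ _ _ Eb]] ->]|->]; first exact: (sub b).
  by apply: (sub (Ordinal m0)); exact: econe_vertical.
move=> p /= /flatten_mapP[b _ ps]; apply: (econe_sub_graph (b := b)).
by rewrite sE; exact: sub_conic_hull.
Qed.

Lemma graph_extremal_generators :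
  exists s : seq W, graph = conic_hull [set` s] /\ forall v, v \in s -> extremal graph v.
Proof.
have [s sE] := graph_finite.
exact: pointed_hull_extremal_generators sE (graph_pointed X0 indep).
Qed.

Lemma graph_idem : graph = conic_hull graph.
Proof.
apply/seteqP; split; first exact: sub_conic_hull.
exact: conic_hull_min.
Qed.

(** Each reduced circuit spans a ray through one of finitely many generators, and a ray carries at
    most one normalized circuit. *)
Lemma Lambda_star_finite : finite_set (Lambda_star X A).
Proof.
have [s [sE _]] := graph_extremal_generators.
(* [g] picks the normalized circuit whose ray contains [p.1], with default 0 if there is none. *)
have /choice[g gP] : forall p : W, exists lam,
    (exists2 lam', Lambda X A lam' & exists2 r, 0 < r & p.1 = r *: lam') ->
    Lambda X A lam /\ exists2 r, 0 < r & p.1 = r *: lam.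
  move=> p; have [[lam Ll lamr]|no] := pselect (exists2 lam', Lambda X A lam' &
      exists2 r, 0 < r & p.1 = r *: lam').
    by exists lam.
  by exists 0 => /no.
apply: (sub_finite_set (B := g @` [set` s])); last exact: finite_image.
move=> lam /Lambda_starE[Ll ext]; have [/= v0 Kv _] := ext.
have [|||p ps [r r0 pE]] := @extremal_generator _ _ [set` s] graph (phi X A lam) (phi X A lam) _ graph_idem ext _ v0.
- by rewrite sE; exact: sub_conic_hull.
- by rewrite -sE.
- by exists 1 => //; rewrite scale1r.
exists p => //; have [|Lg [r' r'0 E]] := gP p.
  by exists lam => //; exists r => //; rewrite pE.
apply/esym; apply: (Lambda_ray_inj (r := r^-1 * r') X0 Lg Ll); first by rewrite mulr_gt0 ?invr_gt0.
rewrite -scalerA -E pE /= scalerA mulVf ?scale1r //.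
by rewrite gt_eqF.
Qed.

Local Notation reduced := (ray_generators X A (Lambda_star X A)).

(** An extremal generator is a positive multiple of [(0, 1)] or of some [phi lam]; in the second
    case [phi lam] inherits extremality, so [lam] is reduced. *)
Lemma graph_reduced : graph = conic_hull reduced.
Proof.
have [s [sE ext]] := graph_extremal_generators.
apply/seteqP; split; last first.
  apply: conic_hull_sub => p [[lam /Lambda_starE[Ll _] ->]|->]; last by right.
  by left; exists lam.
rewrite sE; apply: conic_hull_min => p /= /ext extp; have [p0 Kp _] := extp.
have [|q qs [r r0 qE]] := extremal_generator (sub_conic_hull (S := _)) graph_idem extp Kp p0.
  by exists 1 => //; rewrite scale1r.
have -> : p = r^-1 *: q by rewrite qE scalerA mulVf ?scale1r // gt_eqF.
apply: conic_hullZ; first by rewrite invr_ge0 ltW.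
apply: sub_conic_hull; case: qs => [[lam Ll qlam]|->]; last by right.
left; exists lam => //; apply/Lambda_starE; split=> //.
rewrite -qlam qE; apply: extremal_scale => //.
by rewrite -qE qlam; apply: sub_conic_hull; left; exists lam.
Qed.

Lemma Lambda_star_nonempty : Lambda X A !=set0 -> Lambda_star X A !=set0.
Proof.
move=> [lam Ll]; have : graph (phi X A lam) by apply: sub_conic_hull; left; exists lam.
rewrite graph_reduced => hl; apply: contrapT => /set0P/negP/negPn/eqP S0.
have /eqP[] := Lambda_neq0 Ll.
suff : forall p, conic_hull reduced p -> p.1 = 0 by move=> /(_ _ hl).
move=> p; elim=> // t s v [[lam' Ll' _]|->] _ _ v0; first by move: Ll'; rewrite S0.
by rewrite /= v0 scaler0 addr0.
Qed.

(** By extremality some generator would lie on the ray of [phi lam]: it is not [(0, 1)], as [lam] is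
    nonzero, and a circuit of [L] on that ray would equal [lam]. *)
Lemma Lambda_star_irredundant (L : set 'rV[R]_m) lam :
  L `<=` Lambda_star X A -> Lambda_star X A lam -> ~ L lam ->
  ~ conic_hull (ray_generators X A L) (phi X A lam).
Proof.
move=> sL /Lambda_starE[Ll ext] nL hl; have [v0 Kv _] := ext.
have [||p [[lam' Ll' ->]|->] [r r0]] :=
  extremal_generator (w := phi X A lam) _ graph_idem ext hl v0.
- move=> p pL; apply: sub_conic_hull; case: pL => [[lam' /sL /Lambda_starE[]]|->].
    by move=> Ll' _ ->; left; exists lam'.
  by right.
- by exists 1 => //; rewrite scale1r.
- move=> /(congr1 fst) /= E; apply: nL.
  have /Lambda_starE[Ll'' _] := sL _ Ll'.
  by rewrite -(Lambda_ray_inj X0 Ll Ll'' r0 E).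
- move=> /(congr1 fst) /= /esym/eqP; rewrite scaler_eq0 gt_eqF //=.
  by rewrite (negPf (Lambda_neq0 Ll)).
Qed.

Lemma ray_generators_hull (s : seq 'rV[R]_m) p : uniq s ->
  conic_hull (ray_generators X A [set` s]) p ->
  exists (t : 'rV[R]_m -> R) (t0 : R), [/\ forall lam, 0 <= t lam, 0 <= t0 &
    p = \sum_(lam <- s) t lam *: (phi X A lam : W) + t0 *: ((0, 1) : W)].
Proof.
move=> us; elim=> [|r q v Sq r0 _ [t [t0 [tp t00 ->]]]].
  exists (fun=> 0), 0; split=> //; rewrite scale0r addr0 big1 // => i _.
  by rewrite scale0r.
case: Sq => [[lam /= ls ->]|->]; last first.
  by exists t, (r + t0); split=> //; rewrite ?addr_ge0 // scalerDl addrCA.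
exists (fun lam' => (if lam' == lam then r else 0) + t lam'), t0; split=> //.
  by move=> lam'; rewrite addr_ge0 //; case: ifP.
rewrite addrA; congr (_ + _); under [RHS]eq_bigr do rewrite scalerDl.
rewrite big_split /=; congr (_ + _).
rewrite (bigD1_seq lam) //= eqxx big1 ?addr0 // => l /negPf ->.
by rewrite scale0r.
Qed.

End ReducedCircuits.

(** * Witnessed AGE cones *)

Lemma expR_powR (R : realType) (x w : R) : expR x `^ w = expR (w * x).
Proof. by rewrite /powR gt_eqF ?expR_gt0 // expRK. Qed.

Lemma weighted_amgm (R : realType) (I : finType) (P : pred I) (w x : I -> R) :
  (forall i, P i -> 0 < w i) -> \sum_(i | P i) w i = 1 ->
  (forall i, P i -> 0 <= x i) ->
  \prod_(i | P i) x i `^ w i <= \sum_(i | P i) w i * x i.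
Proof.
move=> w0 w1 x0.
have [[i Pi xi]|nz] := pselect (exists2 i, P i & x i = 0).
  rewrite (bigD1 i) //= xi powR0 ?mul0r ?gt_eqF ?w0 //.
  by apply: sumr_ge0 => j Pj; rewrite mulr_ge0 ?x0 // ltW // w0.
have xp i : P i -> 0 < x i.
  by move=> Pi; rewrite lt_neqAle x0 // andbT eq_sym; apply/eqP => xi; apply: nz; exists i.
set S := \sum_(i | P i) w i * x i.
have S0 : 0 < S.
  have [[i Pi]|/forallNP nP] := pselect (exists i, P i).
    rewrite /S (bigD1 i) //= ltr_pwDl ?mulr_gt0 ?w0 ?xp //.
    by apply: sumr_ge0 => j /andP[Pj _]; rewrite mulr_ge0 ?x0 // ltW // w0.
  move: w1; rewrite big1 => [/esym/eqP|i Pi]; first by rewrite oner_eq0.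
  by case: (nP i).
have -> : \prod_(i | P i) x i `^ w i = expR (\sum_(i | P i) w i * ln (x i)).
  by rewrite expR_sum; apply: eq_bigr => i Pi; rewrite /powR gt_eqF ?xp.
rewrite -[leRHS]lnK ?posrE // ler_expR.
(* This is the weighted sum of [1 + u <= expR u] at [u = ln (x i) - ln S]. *)
have : \sum_(i | P i) w i * (S * (1 + (ln (x i) - ln S))) <= S.
  apply: ler_sum => i Pi; rewrite ler_wpM2l ?(ltW (w0 _ Pi)) //.
  have := expR_ge1Dx (ln (x i) - ln S).
  rewrite expRB !lnK ?posrE ?xp // ler_pdivlMr // => le.
  by rewrite mulrC.
have -> : \sum_(i | P i) w i * (S * (1 + (ln (x i) - ln S))) =
    S * (\sum_(i | P i) w i * ln (x i) + (1 - ln S) * \sum_(i | P i) w i).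
  rewrite mulr_sumr -big_split /= mulr_sumr; apply: eq_bigr => i _; ring.
rewrite w1 mulr1 -[leRHS]mulr1 ler_pM2l //; lra.
Qed.

Section AgeCone.
Variables (R : realType) (n m : nat) (X : set 'rV[R]_n) (A : 'M[R]_(m, n)).
Variables (b : 'I_m) (lam : 'rV[R]_m).
Hypotheses (Nlam : Nset b lam) (lamb : lam 0 b = -1).
Implicit Types (c d e y : 'rV[R]_m).

Local Notation sig := (fine (sigA X A lam)).

Definition weighted_gm c : R :=
  \prod_(a < m | 0 < lam 0 a) (c 0 a / lam 0 a) `^ lam 0 a.

Lemma circuit_pos_neq a : 0 < lam 0 a -> a != b.
Proof. by apply: contraTneq => ->; rewrite lamb oppr_gt0 ltr10. Qed.

Lemma circuit_sum (F : 'I_m -> R) :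
  \sum_a lam 0 a * F a = \sum_(a < m | 0 < lam 0 a) lam 0 a * F a - F b.
Proof.
rewrite (bigD1 b) //= lamb mulN1r addrC; congr (_ - _).
rewrite big_mkcond [RHS]big_mkcond /=; apply: eq_bigr => a _.
have [->|ab] /= := eqVneq a b; first by rewrite lamb oppr_gt0 ltr10.
case: ifPn => //; rewrite -leNgt => la.
suff -> : lam 0 a = 0 by rewrite mul0r.
by apply/eqP; rewrite eq_le la (proj1 Nlam).
Qed.

Lemma circuit_sum_pos : \sum_(a < m | 0 < lam 0 a) lam 0 a = 1.
Proof.
have := circuit_sum (fun=> 1); under eq_bigr do rewrite mulr1.
rewrite (proj2 Nlam); under [in RHS]eq_bigr do rewrite mulr1.
by lra.
Qed.

Lemma age_coneP c : age_cone X A lam c <->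
  (forall a, a != b -> 0 <= c 0 a) /\ - c 0 b * expR sig <= weighted_gm c.
Proof.
split=> -[c0 cb]; split.
- by move=> a /(proj1 Nlam); exact: c0.
- by apply: cb; rewrite lamb oppr_lt0 ltr01.
- by move=> a la; apply: c0; apply: contraTneq la => ->; rewrite lamb oppr_ge0 ler10.
- move=> a la; suff -> : a = b by [].
  by apply/eqP; apply: contraTT la => /(proj1 Nlam); rewrite leNgt.
Qed.

Lemma weighted_gm_ge0 c : 0 <= weighted_gm c.
Proof. by apply: prodr_ge0 => a _; exact: powR_ge0. Qed.

Lemma age_cone_ge0 c : (forall a, 0 <= c 0 a) -> age_cone X A lam c.
Proof.
move=> c0; apply/age_coneP; split=> //; apply: le_trans (weighted_gm_ge0 c).
by rewrite mulNr oppr_le0 mulr_ge0 // expR_ge0.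
Qed.

(** Divide by the mean of [c + d] and apply AM-GM to the ratios: the two arithmetic means add up to
    1. If a relevant entry of [c + d] is zero, both means on the left vanish. *)
Lemma weighted_gm_superadditive c d :
  (forall a, a != b -> 0 <= c 0 a) -> (forall a, a != b -> 0 <= d 0 a) ->
  weighted_gm c + weighted_gm d <= weighted_gm (c + d).
Proof.
move=> c0 d0.
have [[a la cda]|nz] := pselect (exists2 a, 0 < lam 0 a & c 0 a + d 0 a = 0).
  have ab := circuit_pos_neq la.
  have ca : c 0 a = 0 by have := c0 _ ab; have := d0 _ ab; lra.
  have da : d 0 a = 0 by have := c0 _ ab; have := d0 _ ab; lra.
  suff z e : e 0 a = 0 -> weighted_gm e = 0.
    by rewrite (z c) // (z d) // addr0 weighted_gm_ge0.
  by move=> ea; rewrite /weighted_gm (bigD1 a) //= ea mul0r powR0 ?mul0r // gt_eqF.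
have cdp a : 0 < lam 0 a -> 0 < c 0 a + d 0 a.
  move=> la; have ab := circuit_pos_neq la.
  rewrite lt_neqAle eq_sym addr_ge0 ?c0 ?d0 // andbT.
  by apply/eqP => z; apply: nz; exists a.
have bound e : (forall a, a != b -> 0 <= e 0 a) -> weighted_gm e <=
    (\sum_(a < m | 0 < lam 0 a) lam 0 a * (e 0 a / (c 0 a + d 0 a))) * weighted_gm (c + d).
  move=> e0.
  have -> : weighted_gm e = (\prod_(a < m | 0 < lam 0 a)
      (e 0 a / (c 0 a + d 0 a)) `^ lam 0 a) * weighted_gm (c + d).
    rewrite /weighted_gm -big_split; apply: eq_bigr => a la /=.
    have p := cdp _ la; have ea := e0 _ (circuit_pos_neq la).
    rewrite mxE -powRM; [|by rewrite divr_ge0 // ltW|by rewrite divr_ge0 // ltW].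
    by rewrite mulrA divfK // gt_eqF.
  rewrite ler_wpM2r ?weighted_gm_ge0 // weighted_amgm ?circuit_sum_pos // => a la.
  by rewrite divr_ge0 ?e0 ?circuit_pos_neq // ltW // cdp.
apply: le_trans (lerD (bound _ c0) (bound _ d0)) _.
rewrite -mulrDl -big_split /= (eq_bigr (fun a => lam 0 a)) => [|a la].
  by rewrite circuit_sum_pos mul1r.
by rewrite -mulrDr -mulrDl divff ?mulr1 // gt_eqF // cdp.
Qed.

Lemma age_coneD c d :
  age_cone X A lam c -> age_cone X A lam d -> age_cone X A lam (c + d).
Proof.
move=> /age_coneP[c0 cb] /age_coneP[d0 db]; apply/age_coneP; split=> [a ab|].
  by rewrite mxE addr_ge0 ?c0 ?d0.
apply: le_trans (weighted_gm_superadditive c0 d0).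
by rewrite mxE opprD mulrDl lerD.
Qed.

(** AM-GM bounds the positive terms below by [weighted_gm c * expR s], and the AGE inequality with
    the hypothesis on [y] makes this at least [- c 0 b * expR (y 0 b)]. Exponents evaluated at a
    point of [X] give nonnegativity there; general [y] serve minimality. *)
Lemma age_cone_dual c y : age_cone X A lam c ->
  0 <= \sum_a lam 0 a * y 0 a + sig -> 0 <= \sum_a c 0 a * expR (y 0 a).
Proof.
move=> /age_coneP[c0 cb]; rewrite circuit_sum => lamy.
have [cb0|cb0] := leP 0 (c 0 b).
  apply: sumr_ge0 => a _; rewrite mulr_ge0 ?expR_ge0 //.
  by have [->|/c0] := eqVneq a b.
set s := \sum_(a < m | 0 < lam 0 a) lam 0 a * y 0 a in lamy.
have gmE : weighted_gm c * expR s =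
    \prod_(a < m | 0 < lam 0 a) (c 0 a / lam 0 a * expR (y 0 a)) `^ lam 0 a.
  rewrite /weighted_gm expR_sum -big_split; apply: eq_bigr => a la /=.
  rewrite [RHS]powRM ?expR_ge0 //; first by rewrite expR_powR.
  by rewrite divr_ge0 ?c0 ?circuit_pos_neq // ltW.
have le1 : weighted_gm c * expR s <= \sum_(a < m | 0 < lam 0 a) c 0 a * expR (y 0 a).
  rewrite gmE; apply: (le_trans (weighted_amgm _ circuit_sum_pos _)) => //.
    move=> a la; rewrite mulr_ge0 ?expR_ge0 // divr_ge0 ?c0 ?circuit_pos_neq //.
    exact: ltW.
  apply: ler_sum => a la.
  by rewrite mulrA [lam 0 a * _]mulrC divfK // gt_eqF.
have le2 : \sum_(a < m | 0 < lam 0 a) c 0 a * expR (y 0 a) <=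
    \sum_(a < m | a != b) c 0 a * expR (y 0 a).
  rewrite big_mkcond [leRHS]big_mkcond; apply: ler_sum => a _ /=.
  case: ifPn => [/circuit_pos_neq -> //|_]; case: ifPn => // ab.
  by rewrite mulr_ge0 ?c0 ?expR_ge0.
rewrite (bigD1 b) //= -[_ * _]opprK addrC subr_ge0 -mulNr.
apply: le_trans le2; apply: le_trans le1.
apply: (@le_trans _ _ (- c 0 b * expR sig * expR s)); last first.
  by rewrite ler_wpM2r ?expR_ge0.
rewrite -mulrA -expRD ler_wpM2l ?ler_expR //; first by rewrite oppr_ge0 ltW.
by lra.
Qed.

(** For positive [t] the ratios of coefficients to entries of [lam] are [t * expR (- y 0 a)], so the
    geometric mean is explicit and the AGE inequality becomes the hypothesis on [y]. *)
Lemma age_cone_intro t y : 0 <= t -> \sum_a lam 0 a * y 0 a + sig <= 0 ->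
  age_cone X A lam (\row_a (t * lam 0 a * expR (- y 0 a))).
Proof.
rewrite le_eqVlt => /predU1P[<- _|t0].
  by apply: age_cone_ge0 => a; rewrite mxE !mul0r.
rewrite circuit_sum => lamy; apply/age_coneP; split=> [a ab|].
  by rewrite mxE !mulr_ge0 ?expR_ge0 ?(ltW t0) // (proj1 Nlam).
set s := \sum_(a < m | 0 < lam 0 a) lam 0 a * y 0 a in lamy.
have -> : weighted_gm (\row_a (t * lam 0 a * expR (- y 0 a))) = t * expR (- s).
  rewrite -[X in X * _](lnK t0) -expRD -[X in X + _]mulr1 -circuit_sum_pos.
  rewrite mulr_sumr -sumrN -big_split expR_sum; apply: eq_bigr => a la /=.
  rewrite mxE mulrAC mulfK ?gt_eqF // -[X in X * _](lnK t0) -expRD expR_powR.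
  by congr expR; ring.
rewrite mxE lamb mulrN1 !mulNr opprK -mulrA -expRD ler_wpM2l ?(ltW t0) //.
by rewrite ler_expR; lra.
Qed.

End AgeCone.

(** * Minimizing exponential sums over a polyhedron *)

Section Polyhedron.
Variables (R : realType) (n m k : nat) (G : 'M[R]_(k, n)) (h : 'rV[R]_k).
Variables (g : 'I_m -> 'rV[R]_n).
Implicit Types (x : 'rV[R]_n) (t : 'rV[R]_m).

Local Notation X := [set x | forall j, dotp (row j G) x <= h 0 j].

(** Without such a direction, Farkas writes each [- g e] as a nonnegative combination of rows of [G]
    and of the [g a]. Adding these identities over [e] gives the weights, where each [g e] itself
    contributes 1. *)
Lemma recession_or_bound (P : pred 'I_m) :
  (exists r, [/\ forall j, dotp (row j G) r <= 0, forall a, P a -> dotp (g a) r <= 0 &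
     exists2 a, P a & dotp (g a) r < 0]) \/
  (exists (w : 'I_m -> R) (C : R), (forall a, 1 <= w a) /\
     forall x, X x -> - C <= \sum_(a | P a) w a * dotp (g a) x).
Proof.
have [|norec] := pselect (exists r, [/\ forall j, dotp (row j G) r <= 0,
  forall a, P a -> dotp (g a) r <= 0 & exists2 a, P a & dotp (g a) r < 0]).
  by left.
right.
have /choice[t tP] : forall e, exists t : 'I_k + 'I_m -> R, (forall i, 0 <= t i) /\
    (P e -> - g e = \sum_j t (inl j) *: row j G + \sum_(a | P a) t (inr a) *: g a).
  move=> e; have [Pe|] := boolP (P e); last by exists (fun=> 0).
  have [|t t0 E] := @farkas_family R n ('I_k + 'I_m)%type
      (fun i => match i with inl j => (row j G, 0) | inr a => if P a then (g a, 0) else 0 end)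
      (- g e, 0).
    move=> [q1 q2] ineq; rewrite /pdot /= mul0r addr0 dotpNl oppr_le0 leNgt.
    apply/negP => lt0; apply: norec; exists q1; split; last by exists e.
      by move=> j; have := ineq (inl j); rewrite /pdot /= mul0r addr0.
    by move=> a Pa; have := ineq (inr a); rewrite /pdot /= Pa /= mul0r addr0.
  exists t; split=> // _; move/(congr1 fst): E => /= ->.
  rewrite big_sumType /= !fst_sum; congr (_ + _).
  rewrite [RHS]big_mkcond; apply: eq_bigr => a _ /=.
  by case: ifP => //= _; rewrite scaler0.
exists (fun a => 1 + \sum_(e | P e) t e (inr a)).
exists (\sum_(e | P e) \sum_j t e (inl j) * h 0 j); split=> [a|x Xx].
  by rewrite lerDl; apply: sumr_ge0 => e _; exact: (tP e).1.
have -> : \sum_(a | P a) (1 + \sum_(e | P e) t e (inr a)) * dotp (g a) x =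
    \sum_(e | P e) (dotp (g e) x + \sum_(a | P a) t e (inr a) * dotp (g a) x).
  rewrite big_split /= [X in _ = _ + X]exchange_big /= -big_split /=; apply: eq_bigr => a _ /=.
  by rewrite mulrDl mul1r mulr_suml.
rewrite -sumrN; apply: ler_sum => e Pe /=.
have [t0 /(_ Pe) E] := tP e.
have : dotp (- g e) x = \sum_j t e (inl j) * dotp (row j G) x +
    \sum_(a | P a) t e (inr a) * dotp (g a) x.
  by rewrite E dotpDl !dotp_suml; congr (_ + _); apply: eq_bigr => i _; rewrite dotpZl.
have : \sum_j t e (inl j) * dotp (row j G) x <= \sum_j t e (inl j) * h 0 j.
  by apply: ler_sum => j _; rewrite ler_wpM2l.
by rewrite dotpNl; lra.
Qed.

Lemma continuous_dotp (u : 'rV[R]_m) : continuous (dotp u).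
Proof.
apply: (@continuous_big R 'I_m +%R 0 xpredT _ 'rV[R]_m _ (fun j (t : 'rV[R]_m) => u 0 j * t 0 j)).
  exact: add_continuous.
move=> j _ t; apply: continuousM; first exact: cst_continuous.
exact: coord_continuous.
Qed.

(* By Farkas' lemma the image is an intersection of closed half-spaces. *)
Lemma closed_linear_image : closed [set t : 'rV[R]_m | exists2 x, X x & forall a, t 0 a = dotp (g a) x].
Proof.
(* The infeasibility certificates: nonnegative multipliers of the inequalities and free multipliers
   of the equations that cancel in [x]. *)
pose D := [set q : 'rV[R]_k * 'rV[R]_m | (forall j, 0 <= q.1 0 j) /\
  q.1 *m G + \sum_a q.2 0 a *: g a = 0].
rewrite (_ : [set t : 'rV[R]_m | _] = \bigcap_(q in D) [set t : 'rV[R]_m | - dotp q.1 h <= dotp q.2 t]).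
  apply: closed_bigI => q _; apply: (@preimage_closed 'rV[R]_m R (dotp q.2) [set y | - dotp q.1 h <= y]);
    last exact: closed_ge.
  by move=> t _; exact: continuous_dotp.
apply/seteqP; split=> [t [x Xx tx] [mu ka] [/= mu0 eq0]|t tD].
  have -> : dotp ka t = - dotp (mu *m G) x.
    move/eqP: eq0; rewrite addr_eq0 => /eqP ->; rewrite dotpNl opprK dotp_suml.
    by apply: eq_bigr => a _; rewrite dotpZl tx.
  rewrite lerN2 dotp_mulmx; apply: ler_sum => j _.
  by rewrite ler_wpM2l.
apply: contrapT => nx.
(* Each equation enters as two opposite inequalities; the target [(0, 1)] says that no solution has
   a positive homogenizing coordinate. *)
have [|s s0] := @farkas_family R n ('I_k + ('I_m + ('I_m + unit)))%type
  (fun i => match i with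
    | inl j => (row j G, - h 0 j)
    | inr (inl a) => (g a, - t 0 a)
    | inr (inr (inl a)) => (- g a, t 0 a)
    | inr (inr (inr _)) => (0, -1)
    end) (0, 1).
  move=> [x r] ineq; rewrite /pdot /= dotp0l add0r mul1r leNgt; apply/negP => r0.
  apply: nx; exists (r^-1 *: x) => [j|a].
    have := ineq (inl j); rewrite /pdot /= dotpZr ler_pdivrMl //.
    by rewrite mulNr subr_le0 [r * _]mulrC.
  have := ineq (inr (inl a)); have := ineq (inr (inr (inl a))).
  rewrite /pdot /= dotpNl dotpZr => le1 le2.
  have -> : dotp (g a) x = t 0 a * r by lra.
  by rewrite mulrCA mulVf ?mulr1 // gt_eqF.
rewrite !big_sumType /= => E.
have E1 := congr1 fst E; have E2 := congr1 snd E.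
move: E1 E2; rewrite /= !fst_sum !snd_sum /= => E1 E2.
pose mu := \row_j s (inl j); pose ka := \row_a (s (inr (inl a)) - s (inr (inr (inl a)))).
have le : - dotp mu h <= dotp ka t.
  apply: (tD (mu, ka)).
  split; first by move=> j; rewrite mxE.
  rewrite [RHS]E1 mulmx_sum_row; congr (_ + _); first by apply: eq_bigr => j _; rewrite mxE.
  rewrite addrA -big_split [X in _ = _ + X]big1 ?addr0; last by move=> i _; rewrite scaler0.
  by apply: eq_bigr => a _ /=; rewrite mxE scalerBl scalerN.
have muE : \sum_i s (inl i) * - h 0 i = - dotp mu h.
  by rewrite /dotp -sumrN; apply: eq_bigr => j _; rewrite mxE mulrN.
have kaE : \sum_i s (inr (inl i)) * - t 0 i + \sum_i s (inr (inr (inl i))) * t 0 i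
    = - dotp ka t.
  rewrite /dotp -sumrN -big_split; apply: eq_bigr => a _ /=; rewrite mxE; ring.
have last0 : \sum_i s (inr (inr (inr i))) * (-1) <= 0.
  by apply: sumr_le0 => i _; rewrite mulr_ge0_le0 // oppr_le0.
move: E2 muE kaE last0; rewrite /GRing.scale /=; lra.
Qed.

(** In the coordinates [dotp (g a) x] a sublevel set is bounded: above because each single term is
    at most [F0], below because of the weighted bound. The image of [X] is closed, so the minimum is
    over a compact set. *)
Lemma sum_exp_attains_min (P : pred 'I_m) (c : 'I_m -> R) (w : 'I_m -> R) (C : R) :
  X !=set0 -> (forall a, ~~ P a -> g a = 0) -> (forall a, P a -> 0 < c a) ->
  (forall a, 1 <= w a) ->
  (forall x, X x -> - C <= \sum_(a | P a) w a * dotp (g a) x) ->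
  exists2 x0, X x0 & forall x, X x ->
    \sum_(a | P a) c a * expR (dotp (g a) x0) <= \sum_(a | P a) c a * expR (dotp (g a) x).
Proof.
move=> [x0 Xx0] g0 c0 w1 wC.
pose F (t : 'rV[R]_m) := \sum_(a | P a) c a * expR (t 0 a).
pose T x : 'rV[R]_m := \row_a dotp (g a) x.
have FT x : \sum_(a | P a) c a * expR (dotp (g a) x) = F (T x).
  by apply: eq_bigr => a _; rewrite mxE.
pose F0 := F (T x0); pose B := \sum_(a | P a) F0 / c a.
have F00 : 0 <= F0.
  by apply: sumr_ge0 => a Pa; rewrite mulr_ge0 ?expR_ge0 // ltW // c0.
have term0 a : P a -> 0 <= F0 / c a by move=> Pa; rewrite divr_ge0 // ltW // c0.
have B0 : 0 <= B by apply: sumr_ge0.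
pose M := B + `|C| + \sum_(a | P a) w a * B.
have w0 a : 0 <= w a by apply: le_trans (w1 a); exact: ler01.
have wB0 : 0 <= \sum_(a | P a) w a * B by apply: sumr_ge0 => a _; rewrite mulr_ge0.
have upper x a : F (T x) <= F0 -> P a -> dotp (g a) x <= B.
  move=> le Pa; apply: (@le_trans _ _ (F0 / c a)); last first.
    by rewrite /B (bigD1 a) //= lerDl; apply: sumr_ge0 => e /andP[Pe _]; exact: term0.
  rewrite ler_pdivlMr ?c0 //; apply: le_trans le.
  rewrite /F (bigD1 a) //= ler_wpDr //.
    by apply: sumr_ge0 => e /andP[Pe _]; rewrite mulr_ge0 ?expR_ge0 // ltW // c0.
  rewrite mulrC mxE ler_wpM2l ?(ltW (c0 a Pa)) //.
  by have := expR_ge1Dx (dotp (g a) x); lra.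
have lower x a : X x -> F (T x) <= F0 -> P a -> - (`|C| + \sum_(a | P a) w a * B) <= dotp (g a) x.
  move=> Xx le Pa; have := wC x Xx; rewrite (bigD1 a) //= => Cle.
  have le1 : \sum_(i | P i && (i != a)) w i * dotp (g i) x <= \sum_(i | P i && (i != a)) w i * B.
    by apply: ler_sum => i /andP[Pi _]; rewrite ler_wpM2l // upper.
  have le2 : \sum_(i | P i && (i != a)) w i * B <= \sum_(i | P i) w i * B.
    by rewrite [leRHS](bigD1 a) //= lerDr mulr_ge0.
  have [ga|ga] := leP 0 (dotp (g a) x); first by have := normr_ge0 C; lra.
  have : w a * dotp (g a) x <= dotp (g a) x by rewrite ger_nMl.
  by have := ler_norm C; lra.
pose K := [set t : 'rV[R]_m | forall i, `[- M, M]%classic (t ord0 i)] `&`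
  [set t : 'rV[R]_m | exists2 x, X x & forall a, t 0 a = dotp (g a) x].
have cK : compact K.
  apply: compact_closedI closed_linear_image.
  by apply: (@rV_compact _ _ (fun=> `[- M, M]%classic)) => _; exact: segment_compact.
have inK x : X x -> F (T x) <= F0 -> K (T x).
  move=> Xx le; split; last by exists x => // a; rewrite mxE.
  move=> a /=; rewrite mxE in_itv /=.
  have [Pa|nPa] := boolP (P a).
    have := upper x a le Pa; have := lower x a Xx le Pa.
    by have := normr_ge0 C; rewrite /M => *; apply/andP; split; lra.
  rewrite g0 // dotp0l oppr_le0 andbb /M; have := normr_ge0 C; lra.
have contF : continuous F.
  apply: (@continuous_big R 'I_m +%R 0 P _ 'rV[R]_m _ (fun a (t : 'rV[R]_m) => c a * expR (t 0 a))).
    exact: add_continuous.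
  move=> a _ t; apply: (@continuousM R 'rV[R]_m (cst (c a)) (fun u => expR (u 0 a))).
    exact: cst_continuous.
  apply: (continuous_comp (f := fun t : 'rV[R]_m => t 0 a)).
    exact: coord_continuous.
  exact: continuous_expR.
have [||t] := @EVT_min_rV R m F K _ cK.
- by exists (T x0); apply: inK.
- by apply: continuous_subspaceT.
rewrite inE => -[_ [x1 Xx1 tx1]] tmin.
have {tx1} tE : t = T x1 by apply/rowP => a; rewrite mxE tx1.
exists x1 => // x Xx; rewrite !FT -tE.
have [le|lt] := leP (F (T x)) F0; first by apply: tmin; rewrite inE; exact: inK.
apply: le_trans (ltW lt); apply: tmin; rewrite inE; exact: inK.
Qed.

End Polyhedron.

(** A one-sided derivative at 0, replaced by the quadratic bound on [expR (s * u)] for [s] in (0,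
    1]. *)
Lemma sum_exp_first_order (R : realType) (I : finType) (P : pred I) (w d : I -> R) :
  (forall a, P a -> 0 <= w a) ->
  (forall s, 0 < s <= 1 -> \sum_(a | P a) w a <= \sum_(a | P a) w a * expR (s * d a)) ->
  0 <= \sum_(a | P a) w a * d a.
Proof.
move=> w0 ineq; set K := \sum_(a | P a) _; rewrite leNgt; apply/negP => K0.
pose D := \sum_(a | P a) w a * (d a ^+ 2 * expR `|d a|).
have D0 : 0 <= D.
  by apply: sumr_ge0 => a Pa; rewrite mulr_ge0 ?w0 // mulr_ge0 ?sqr_ge0 ?expR_ge0.
have bound (s u : R) : 0 < s <= 1 -> expR (s * u) <= 1 + s * u + s ^+ 2 * (u ^+ 2 * expR `|u|).
  move=> /andP[s0 s1].
  have e1 : expR (s * u) * (1 - s * u) <= 1.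
    by rewrite -ler_pdivlMl ?expR_gt0 // mulr1 -expRN expR_ge1Dx.
  have [u0|u0] := leP 0 u.
    have e2 : expR (s * u) <= expR `|u| by rewrite ler_expR ger0_norm // ler_piMl.
    have : expR (s * u) * (s * u) ^+ 2 <= expR `|u| * (s * u) ^+ 2.
      by rewrite ler_wpM2r // sqr_ge0.
    have su : 0 <= s * u by rewrite mulr_ge0 // ltW.
    have : 0 <= s * u * (1 - expR (s * u) * (1 - s * u)) by rewrite mulr_ge0 // subr_ge0.
    rewrite !exprMn; nra.
  have e3 : 0 < expR (s * u) <= 1.
    by rewrite expR_gt0 /= -expR0 ler_expR mulr_ge0_le0 // ltW.
  have su : 0 <= - (s * u) by rewrite oppr_ge0 mulr_ge0_le0 // ltW.
  have e4 : 1 <= expR `|u| by rewrite -expR0 ler_expR.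
  have e5 : (s * u) ^+ 2 <= (s * u) ^+ 2 * expR `|u| by rewrite ler_peMr // sqr_ge0.
  move: e5; rewrite !exprMn mulrA.
  have := expR_ge1Dx (- (s * u)); nra.
(* For this step [K + s * D] equals [s * K], which is negative. *)
pose s := - K / (D - K).
have DK : 0 < D - K by lra.
have s01 : 0 < s <= 1.
  by rewrite divr_gt0 ?oppr_gt0 //= ler_pdivrMr // mul1r; lra.
have := ineq s s01.
have : \sum_(a | P a) w a * expR (s * d a) <=
    \sum_(a | P a) w a + s * K + s ^+ 2 * D.
  rewrite !mulr_sumr -!big_split; apply: ler_sum => a Pa /=.
  have := ler_wpM2l (w0 a Pa) (bound s (d a) s01); lra.
have sE : s * (D - K) = - K by rewrite /s divfK // gt_eqF.
move: s01 => /andP[s0 s1] le1 le2.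
have : 0 <= s * (K + s * D) by lra.
rewrite pmulr_rge0 //; nra.
Qed.

(** * Decomposition *)

Section Decomposition.
Variables (R : realType) (n m : nat) (X : set 'rV[R]_n) (A : 'M[R]_(m, n)).
Hypotheses (X0 : X !=set0) (polyX : polyhedron X) (m0 : (0 < m)%N).
Hypothesis indep : exp_lin_indep X A.
Let W := ('rV[R]_m * R^o)%type.
Implicit Types (c d e nu lam : 'rV[R]_m) (x : 'rV[R]_n) (b : 'I_m).

(** List form of the Minkowski sum, which agrees with it on duplicate-free lists. *)
Definition age_sum (s : seq 'rV[R]_m) : set 'rV[R]_m :=
  [set c | exists d : 'rV[R]_m -> 'rV[R]_m,
     (forall lam, lam \in s -> age_cone X A lam (d lam)) /\ c = \sum_(lam <- s) d lam].

Lemma minkowski_sum_seq (s : seq 'rV[R]_m) : uniq s ->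
  minkowski_sum [set` s] (age_cone X A) = age_sum s.
Proof.
by move=> us; apply/seteqP; split=> c [d [ds E]]; exists d; split=> //;
  rewrite E ?(fsbig_seq _ _ us) // -(fsbig_seq _ _ us).
Qed.

Lemma age_sumD (s : seq 'rV[R]_m) c d : [set` s] `<=` Lambda X A ->
  age_sum s c -> age_sum s d -> age_sum s (c + d).
Proof.
move=> sL [f [fs ->]] [g [gs ->]]; exists (fun lam => f lam + g lam).
split=> [lam ls|]; last by rewrite big_split.
have [b [Nl lb _ _]] := Lambda_econe X0 (sL _ ls).
by apply: (age_coneD Nl lb); [exact: fs|exact: gs].
Qed.

Lemma age_sum_ge0 (s : seq 'rV[R]_m) c : [set` s] `<=` Lambda X A -> uniq s ->
  s != [::] -> (forall a, 0 <= c 0 a) -> age_sum s c.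
Proof.
case: s => // l s sL /= /andP[ls _] _ c0.
exists (fun lam => if lam == l then c else 0); split=> [lam lin|].
  have [b [Nl lb _ _]] := Lambda_econe X0 (sL _ lin).
  by apply: (age_cone_ge0 X A Nl lb) => a; case: eqP => // _; rewrite mxE.
rewrite big_cons eqxx big1_seq ?addr0 // => lam /andP[_ lin].
by case: eqP lin => // ->; rewrite (negPf ls).
Qed.

Definition shifted (b a : 'I_m) : 'rV[R]_n := row a A - row b A.

(** Division by the exponential of [alpha_b] keeps signs and makes the only possibly negative term
    constant. *)
Definition normalized_signomial b c x : R :=
  \sum_a c 0 a * expR (dotp (shifted b a) x).

Lemma signomial_normalized b c x :
  signomial A c x = expR (dotp (row b A) x) * normalized_signomial b c x.
Proof.
rewrite /signomial mulr_sumr; apply: eq_bigr => a _.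
by rewrite mulrCA -expRD dotpBl addrC subrK.
Qed.

Lemma sage_coneP b c : sage_cone X A b c <->
  (forall a, a != b -> 0 <= c 0 a) /\ forall x, X x -> 0 <= normalized_signomial b c x.
Proof.
by split=> -[c0 ge0]; split=> // x /ge0; rewrite (signomial_normalized b)
  pmulr_rge0 ?expR_gt0.
Qed.

Lemma shifted_refl b : shifted b b = 0.
Proof. exact: subrr. Qed.

Lemma circuit_shifted_sum b' b lam x : Nset b' lam ->
  \sum_a lam 0 a * dotp (shifted b a) x = dotp (lam *m A) x.
Proof.
move=> [_ lamS]; under eq_bigr do rewrite dotpBl mulrBr.
by rewrite sumrB -mulr_suml lamS mul0r subr0 dotp_mulmx.
Qed.

(* At a minimizer [x0] the first-order condition yields a point of [econe b]
   with zero slack at [x0]; every reduced circuit used to generate it then also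
   has zero slack at [x0], which is equality in its AGE inequality. *)
Lemma age_sum_of_minimizer (s : seq 'rV[R]_m) b c x0 :
  uniq s -> s != [::] -> [set` s] = Lambda_star X A ->
  (forall x y r, X x -> X y -> 0 < r <= 1 -> X (x + r *: (y - x))) ->
  sage_cone X A b c -> X x0 ->
  (forall x, X x -> normalized_signomial b c x0 <= normalized_signomial b c x) ->
  age_sum s c.
Proof.
move=> us sn sE convX /sage_coneP[c0 cX] Xx0 min0.
have sL : [set` s] `<=` Lambda X A by rewrite sE => lam [].
pose w a := c 0 a * expR (dotp (shifted b a) x0).
have w0 a : a != b -> 0 <= w a by move=> /c0 ca; rewrite mulr_ge0 ?expR_ge0.
have normE x : normalized_signomial b c x =
    c 0 b + \sum_(a | a != b) w a * expR (dotp (shifted b a) (x - x0)).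
  rewrite /normalized_signomial (bigD1 b) //= shifted_refl dotp0l expR0 mulr1.
  congr (_ + _); apply: eq_bigr => a _.
  by rewrite -mulrA -expRD dotpBr addrC subrK.
have first_order x : X x -> 0 <= \sum_(a | a != b) w a * dotp (shifted b a) (x - x0).
  move=> Xx; apply: sum_exp_first_order => // r r01.
  have := min0 _ (convX _ _ r Xx0 Xx r01); rewrite !normE lerD2l subrr => le.
  apply: (le_trans _ (le_trans le _)); apply: ler_sum => a _.
    by rewrite dotp0r expR0 mulr1.
  by rewrite [x0 + _]addrC addrK dotpZr.
pose nu : 'rV[R]_m := \row_a (if a == b then - \sum_(e | e != b) w e else w a).
have nuN : Nset b nu.
  split=> [a ab|]; first by rewrite mxE (negPf ab) w0.
  rewrite (bigD1 b) //= mxE eqxx addrC; apply/eqP; rewrite subr_eq0; apply/eqP.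
  by apply: eq_bigr => a /negPf ab; rewrite mxE ab.
have nuE x : dotp (nu *m A) (x - x0) = \sum_(a | a != b) w a * dotp (shifted b a) (x - x0).
  rewrite -(circuit_shifted_sum b _ nuN) (bigD1 b) //= shifted_refl dotp0l mulr0 add0r.
  by apply: eq_bigr => a /negPf ab; rewrite mxE ab.
(* The height is chosen for zero slack at [x0]; nonnegative slack on [X] is then the first-order
   condition. *)
pose p : W := (nu, - dotp (nu *m A) x0).
have pE : econe X A b p.
  split=> // x /first_order; rewrite -nuE /slack /= dotpBr.
  by lra.
have p0 : slack A p x0 = 0 by rewrite /slack /= subrr.
have := econe_sub_graph X0 polyX pE.
rewrite (graph_reduced X0 polyX m0 indep) -sE.
move=> /(ray_generators_hull us)[t [t0 [tge0 t00 pt]]].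
have slack_ge0 lam : lam \in s -> 0 <= slack A (phi X A lam) x0.
  by move=> /sL /(Lambda_econe X0)[b' [_ _ fin _]]; exact: phi_slack_ge0.
have slackE : slack A p x0 = \sum_(lam <- s) t lam * slack A (phi X A lam) x0 + t0.
  rewrite pt slackD slackZ slack_vertical mulr1; congr (_ + _).
  elim/big_rec2: _ => [|lam u v _ <-]; first by rewrite slack_vertical.
  by rewrite slackD slackZ.
have tight lam : lam \in s -> t lam * slack A (phi X A lam) x0 = 0.
  move=> ls; move: slackE; rewrite p0 (bigD1_seq lam) //= => E.
  have le1 : 0 <= t lam * slack A (phi X A lam) x0 by rewrite mulr_ge0 ?slack_ge0.
  have le2 : 0 <= \sum_(i <- s | i != lam) t i * slack A (phi X A i) x0.
    rewrite big_seq_cond; apply: sumr_ge0 => i /andP[is_ _].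
    by rewrite mulr_ge0 ?slack_ge0.
  by lra.
have nut : nu = \sum_(lam <- s) t lam *: lam.
  by move/(congr1 fst): pt; rewrite /= fst_sum scaler0 addr0.
pose y : 'rV[R]_m := \row_a dotp (shifted b a) x0.
pose f lam : 'rV[R]_m := \row_a (t lam * lam 0 a * expR (- y 0 a)).
have fage lam : lam \in s -> age_cone X A lam (f lam).
  move=> ls; have [b' [Nl lb _ _]] := Lambda_econe X0 (sL _ ls).
  have [tl|tl] := eqVneq (t lam) 0.
    by apply: (age_cone_ge0 X A Nl lb) => a; rewrite mxE tl !mul0r.
  apply: (age_cone_intro Nl lb) => //.
  have /eqP := tight _ ls; rewrite mulf_eq0 (negPf tl) => /eqP sl.
  under eq_bigr do rewrite [y _ _]mxE.
  by rewrite (circuit_shifted_sum b x0 Nl) -[leRHS]sl.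
(* The factors [expR (- y 0 a)] undo those in [w]; what is missing at [b] is the minimum value,
   which is nonnegative. *)
have cE : c = \sum_(lam <- s) f lam +
    \row_a (if a == b then normalized_signomial b c x0 else 0).
  apply/rowP => a; rewrite !mxE summxE.
  have -> : \sum_(lam <- s) f lam 0 a = nu 0 a * expR (- y 0 a).
    rewrite nut summxE mulr_suml; apply: eq_bigr => lam _.
    by rewrite !mxE.
  rewrite !mxE; have [->|ab] := eqVneq a b.
    rewrite shifted_refl dotp0l oppr0 expR0 mulr1 normE.
    rewrite [X in _ + (_ + X)](eq_bigr w) => [|e _]; last first.
      by rewrite subrr dotp0r expR0 mulr1.
    by rewrite addrCA addNr addr0.
  by rewrite addr0 /w -mulrA -expRD subrr expR0 mulr1.
rewrite cE; apply: age_sumD => //; first by exists f.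
by apply: age_sum_ge0 => // a; rewrite mxE; case: ifP => // _; exact: cX.
Qed.

(* Along [r] the terms with [(alpha_a - alpha_b) r < 0] vanish at infinity, so
   they can be dropped without losing nonnegativity. *)
Lemma sage_drop b c (r : 'rV[R]_n) :
  (forall x s, X x -> 0 <= s -> X (x + s *: r)) ->
  sage_cone X A b c ->
  (forall a, a != b -> c 0 a != 0 -> dotp (shifted b a) r <= 0) ->
  sage_cone X A b (\row_a (if dotp (shifted b a) r < 0 then 0 else c 0 a)).
Proof.
move=> Xr /sage_coneP[c0 cX] rle; set c' := \row_a _.
apply/sage_coneP; split=> [a ab|x Xx].
  by rewrite mxE; case: ifP => // _; exact: c0.
(* For negative [u] and positive [s], [expR (s * u)] is at most [1 / (s * - u)], so the terms to be
   dropped add up to at most [D / s] at [x + s *: r]. *)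
pose D := \sum_(a | dotp (shifted b a) r < 0)
  c 0 a * expR (dotp (shifted b a) x) / - dotp (shifted b a) r.
have neq_b a : dotp (shifted b a) r < 0 -> a != b.
  by apply: contraTneq => ->; rewrite shifted_refl dotp0l ltxx.
have D0 : 0 <= D.
  apply: sumr_ge0 => a lt; rewrite divr_ge0 ?mulr_ge0 ?expR_ge0 ?c0 ?neq_b //.
  by rewrite oppr_ge0 ltW.
have bound s : 0 < s -> 0 <= normalized_signomial b c' x + D / s.
  move=> s0; have := cX _ (Xr _ _ Xx (ltW s0)).
  move/le_trans; apply; rewrite /normalized_signomial /D mulr_suml.
  rewrite [X in _ <= _ + X]big_mkcond -big_split /=; apply: ler_sum => a _.
  rewrite mxE dotpDr dotpZr; case: ifPn => [lt|].
    rewrite mul0r add0r expRD mulrA -[leRHS]mulrA ler_wpM2l //.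
      by rewrite mulr_ge0 ?expR_ge0 ?c0 ?neq_b.
    rewrite -invfM -[leLHS]invrK lef_pV2 ?posrE ?invr_gt0 ?expR_gt0 //; last first.
      by rewrite mulr_gt0 // oppr_gt0.
    rewrite -expRN mulNr mulrC -mulrN; apply: le_trans (expR_ge1Dx _).
    by rewrite mulrN lerDr ler01.
  rewrite -leNgt addr0 => ge.
  have [->|ab] := eqVneq a b; first by rewrite shifted_refl !dotp0l mulr0 addr0.
  have [->|ca] := eqVneq (c 0 a) 0; first by rewrite !mul0r.
  have -> : dotp (shifted b a) r = 0 by apply/eqP; rewrite eq_le ge rle.
  by rewrite mulr0 addr0.
rewrite leNgt; apply/negP => neg.
(* With this [s] the bound multiplied by [s] reads [0 <= -1]. *)
pose s := (D + 1) / - normalized_signomial b c' x.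
have s0 : 0 < s by rewrite divr_gt0 ?oppr_gt0 // ltr_wpDl.
have := bound s s0; rewrite -(pmulr_lge0 _ s0) mulrDl divfK ?gt_eqF //.
rewrite /s mulrCA invrN mulrN divff ?lt_eqF //; lra.
Qed.

(** Induction on the number of nonzero terms off [b]: a recession direction removes at least one
    term, leaving a nonnegative remainder; otherwise the minimum is attained. *)
Lemma sage_sub_age_sum (s : seq 'rV[R]_m) b c :
  uniq s -> s != [::] -> [set` s] = Lambda_star X A ->
  sage_cone X A b c -> age_sum s c.
Proof.
move=> us sn sE.
have sL : [set` s] `<=` Lambda X A by rewrite sE => lam [].
have [k [G [h XE]]] := polyX.
have convX x y r : X x -> X y -> 0 < r <= 1 -> X (x + r *: (y - x)).
  rewrite XE /= => Xx Xy /andP[r0 r1] j; rewrite dotpDr dotpZr dotpBr.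
  have := Xx j; have := Xy j; nra.
have [N] := ubnP #|[set a | (a != b) && (c 0 a != 0)]%SET|.
elim: N c => // N IH c; rewrite ltnS => cN sc.
have [c0 cX] := (sage_coneP b c).1 sc.
pose P a := (a != b) && (c 0 a != 0).
pose g a := if P a then shifted b a else 0.
have gP a : P a -> g a = shifted b a by rewrite /g => ->.
have [[r [rG rP [e Pe er]]]|[w [C [w1 wC]]]] := recession_or_bound G h g P.
  pose c' : 'rV[R]_m := \row_a (if dotp (shifted b a) r < 0 then 0 else c 0 a).
  have sc' : sage_cone X A b c'.
    apply: sage_drop => // [x q|a ab ca].
      rewrite XE /= => Xx q0 j; rewrite dotpDr dotpZr -[leRHS]addr0 lerD //.
      by rewrite mulr_ge0_le0.
    by have := rP a; rewrite gP /P ?ab ?ca //; apply.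
  have -> : c = c' + (c - c') by rewrite addrC subrK.
  apply: age_sumD => //; last first.
    apply: age_sum_ge0 => // a; rewrite !mxE; case: ifPn => [lt|_]; last by rewrite subrr.
    rewrite subr0 c0 //; apply: contraTneq lt => ->.
    by rewrite shifted_refl dotp0l ltxx.
  apply: IH sc'; apply: leq_trans cN; apply: proper_card; apply/properP; split.
    apply/fintype.subsetP => a; rewrite !inE mxE => /andP[->] /=.
    by case: ifP => //; rewrite eqxx.
  exists e; rewrite !inE //; move: er; rewrite gP // mxE => ->.
  by rewrite eqxx andbF.
have [|||||x0 Xx0 min0] := @sum_exp_attains_min R n m k G h g P (fun a => c 0 a) w C.
- by rewrite -XE.
- by move=> a /negPf Pa; rewrite /g Pa.
- by move=> a /andP[ab ca]; rewrite lt_neqAle eq_sym ca c0.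
- exact: w1.
- exact: wC.
have normE x : normalized_signomial b c x =
    c 0 b + \sum_(a | P a) c 0 a * expR (dotp (g a) x).
  rewrite /normalized_signomial (bigD1 b) //= shifted_refl dotp0l expR0 mulr1.
  congr (_ + _); rewrite big_mkcond [RHS]big_mkcond; apply: eq_bigr => a _ /=.
  rewrite /g /P; case: eqVneq => //= _; case: eqVneq => //= ->.
  by rewrite mul0r.
apply: (age_sum_of_minimizer us sn sE convX sc (x0 := x0)); rewrite ?XE //.
by move=> x Xx; rewrite !normE lerD2l min0.
Qed.

End Decomposition.

(** * Minimality *)

Section Minimality.
Variables (R : realType) (n m : nat) (X : set 'rV[R]_n) (A : 'M[R]_(m, n)).
Hypothesis X0 : X !=set0.
Implicit Types (c y lam : 'rV[R]_m).

Lemma age_sub_sage b lam : Nset b lam -> lam 0 b = -1 -> (sigA X A lam < +oo)%E ->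
  age_cone X A lam `<=` sage_cone X A b.
Proof.
move=> Nl lb fin c ac; split=> [|x Xx]; first exact: ((age_coneP X A Nl lb c).1 ac).1.
have := age_cone_dual Nl lb (y := \row_a dotp (row a A) x) ac.
under eq_bigr do rewrite mxE; rewrite -dotp_mulmx => /(_ (phi_slack_ge0 X0 fin Xx)).
by under eq_bigr do rewrite mxE.
Qed.

Lemma sage_coneD b c d :
  sage_cone X A b c -> sage_cone X A b d -> sage_cone X A b (c + d).
Proof.
move=> [c0 cX] [d0 dX]; split=> [a ab|x Xx].
  by rewrite mxE addr_ge0 ?c0 ?d0.
rewrite /signomial; under eq_bigr do rewrite mxE mulrDl.
by rewrite big_split addr_ge0 ?cX ?dX.
Qed.

Lemma sage_cone0 b : sage_cone X A b 0.
Proof.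
split=> [a _|x _]; first by rewrite mxE.
by rewrite /signomial big1 // => a _; rewrite mxE mul0r.
Qed.

Lemma age_sum_sub_sage (s : seq 'rV[R]_m) : (0 < m)%N -> [set` s] `<=` Lambda X A ->
  age_sum X A s `<=` sage_cone_all X A.
Proof.
move=> m0 sL c [d [ds ->]].
have /choice[b bP] : forall lam, exists b, lam \in s -> sage_cone X A b (d lam).
  move=> lam; case: (boolP (lam \in s)) => [ls|]; last by exists (Ordinal m0).
  have [b [Nl lb fin _]] := Lambda_econe X0 (sL _ ls).
  by exists b => _; apply: (age_sub_sage Nl lb fin); exact: ds.
(* The summands are grouped by the negative index of their circuit. *)
exists (fun beta => \sum_(lam <- s | b lam == beta) d lam); split.
  move=> beta; rewrite big_seq_cond.
  elim/big_rec: _ => [|lam v /andP[ls /eqP <-] sv]; first exact: sage_cone0.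
  by apply: sage_coneD => //; exact: bP.
by rewrite (partition_big b xpredT).
Qed.

(** The point of [age_cone_intro] with [y] lowered by [eta] at [b]. Its value under
    [c |-> \sum_a c 0 a * expR (y 0 a)] is [1 - expR eta] for a normalized circuit. *)
Definition violated_signomial b lam y (eta : R) : 'rV[R]_m :=
  \row_a (lam 0 a * expR (- (\row_e (if e == b then y 0 e - eta else y 0 e)) 0 a)).

Lemma violated_signomial_age b lam y eta : Nset b lam -> lam 0 b = -1 ->
  \sum_a lam 0 a * y 0 a + fine (sigA X A lam) <= - eta ->
  age_cone X A lam (violated_signomial b lam y eta).
Proof.
move=> Nl lb le; rewrite /violated_signomial.
under eq_mx do rewrite -[lam 0 _]mul1r.
apply: (age_cone_intro Nl lb) => //.
have -> : \sum_a lam 0 a * (\row_e (if e == b then y 0 e - eta else y 0 e)) 0 a =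
    \sum_a lam 0 a * y 0 a + eta.
  rewrite (bigD1 b) //= [in RHS](bigD1 b) //= mxE eqxx lb.
  rewrite (eq_bigr (fun a => lam 0 a * y 0 a)); first by ring.
  by move=> a /negPf ab; rewrite mxE ab.
by lra.
Qed.

Lemma violated_signomial_lt0 b lam y eta : Nset b lam -> lam 0 b = -1 -> 0 < eta ->
  \sum_a violated_signomial b lam y eta 0 a * expR (y 0 a) < 0.
Proof.
move=> Nl lb eta0; rewrite (bigD1 b) //= !mxE eqxx lb mulN1r mulNr -expRD.
rewrite (eq_bigr (lam 0)) => [|a /negPf ab]; last first.
  by rewrite !mxE ab -mulrA -expRD addNr expR0 mulr1.
have : \sum_(a | a != b) lam 0 a = 1.
  by have := Nl.2; rewrite (bigD1 b) //= lb; lra.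
move=> ->; rewrite opprB subrK.
have : 1 < expR eta by rewrite expR_gt1.
by lra.
Qed.

(* A separating functional is perturbed along [(A x, 1)], [x] in [X], so that its
   last coordinate becomes positive and can be scaled to [1]. *)
Lemma separate_circuit (s : seq 'rV[R]_m) lam0 :
  [set` s] `<=` Lambda X A -> Lambda X A lam0 ->
  ~ conic_hull (ray_generators X A [set` s]) (phi X A lam0) ->
  exists y, (forall lam, lam \in s -> 0 <= \sum_a lam 0 a * y 0 a + fine (sigA X A lam)) /\
    \sum_a lam0 0 a * y 0 a + fine (sigA X A lam0) < 0.
Proof.
move=> sL Ll0 nhull; pose W := ('rV[R]_m * R^o)%type.
have [q [qs q0]] : exists q : W,
    (forall p, p \in ((0, 1) : W) :: [seq (phi X A lam : W) | lam <- s] -> pdot p q <= 0) /\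
    0 < pdot (phi X A lam0 : W) q.
  apply: contrapT => /forallNP nq; apply: nhull.
  apply: (@conic_hull_sub _ _ [set` ((0, 1) : W) :: [seq (phi X A lam : W) | lam <- s]]).
    move=> p /=; rewrite inE => /predU1P[->|/mapP[lam ls ->]]; first by right.
    by left; exists lam.
  apply: farkas => q qs; rewrite leNgt; apply/negP => lt.
  by apply: (nq q).
have [x Xx] := X0.
have slack_pdot lam : Lambda X A lam -> 0 <= slack A (phi X A lam) x.
  by move=> /(Lambda_econe X0)[b [_ _ fin _]]; exact: phi_slack_ge0.
have q2 : q.2 <= 0.
  by have := qs (0, 1) (mem_head _ _); rewrite /pdot /= dotp0l add0r mul1r.
(* This makes [ep * slack - pdot] at [phi lam0] equal to [- ep], hence negative; [t] below is the
   resulting last coordinate. *)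
pose ep := pdot (phi X A lam0 : W) q / (1 + slack A (phi X A lam0) x).
have s0 := slack_pdot _ Ll0.
have ep0 : 0 < ep by rewrite divr_gt0 //; lra.
have epE : ep * (1 + slack A (phi X A lam0) x) = pdot (phi X A lam0 : W) q.
  by rewrite divfK // gt_eqF //; lra.
pose t := ep - q.2; have t0 : 0 < t by rewrite /t; lra.
pose y := t^-1 *: (\row_a (ep * dotp (row a A) x) - q.1).
have yE lam : t * (\sum_a lam 0 a * y 0 a + fine (sigA X A lam)) =
    ep * slack A (phi X A lam) x - pdot (phi X A lam : W) q.
  have -> : \sum_a lam 0 a * y 0 a = dotp lam y by [].
  rewrite mulrDr -dotpZr scalerA divff ?gt_eqF // scale1r dotpBr /slack /pdot /=.
  have -> : dotp lam (\row_a (ep * dotp (row a A) x)) = ep * dotp (lam *m A) x.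
    rewrite dotp_mulmx mulr_sumr; apply: eq_bigr => a _; rewrite mxE; ring.
  rewrite /t; ring.
exists y; split=> [lam ls|].
  rewrite -(pmulr_rge0 _ t0) yE.
  have : 0 <= ep * slack A (phi X A lam) x.
    by rewrite mulr_ge0 ?(ltW ep0) // slack_pdot //; exact: sL.
  have : pdot (phi X A lam : W) q <= 0.
    by apply: qs; rewrite inE (map_f (fun lam => phi X A lam : W)) ?orbT.
  by lra.
by rewrite -(pmulr_rlt0 _ t0) yE; lra.
Qed.

End Minimality.

Unset Implicit Arguments.

Theorem theorem5p6 (R : realType) (n m : nat) (X : set 'rV[R]_n)
    (A : 'M[R]_(m, n)) :
  (0 < m)%N -> X !=set0 -> polyhedron X -> exp_lin_indep X A ->
  Lambda X A !=set0 ->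
  [/\ finite_set (Lambda_star X A),
      sage_cone_all X A = minkowski_sum (Lambda_star X A) (age_cone X A) &
      forall L : set 'rV[R]_m, L `<` Lambda_star X A ->
        sage_cone_all X A <> minkowski_sum L (age_cone X A)].
Proof.
move=> m0 X0 polyX indep Lam0.
have fin := Lambda_star_finite X0 polyX m0 indep.
have seqE (L : set 'rV[R]_m) : finite_set L -> exists2 s : seq 'rV[R]_m, uniq s & L = [set` s].
  move=> /finite_seqP[s ->]; exists (undup s); first exact: undup_uniq.
  by apply/seteqP; split=> x /=; rewrite mem_undup.
have [s us sE] := seqE _ fin.
have sL : [set` s] `<=` Lambda X A by rewrite -sE => lam [].
(* An empty sum would contain only 0, whereas nonnegative vectors must be placed in some summand. *)
have sn : s != [::].
  have [lam] := Lambda_star_nonempty X0 polyX m0 indep Lam0.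
  by rewrite sE; case: s {us sE sL}.
have sageE : sage_cone_all X A = age_sum X A s.
  apply/seteqP; split; last exact: age_sum_sub_sage.
  move=> c [d [dsage ->]]; elim/big_rec: _ => [|b v _ hv].
    by apply: age_sum_ge0 => // a; rewrite mxE.
  by apply: age_sumD => //; apply: (sage_sub_age_sum X0 polyX m0 indep) (dsage b).
split=> //; first by rewrite sageE sE minkowski_sum_seq.
move=> L [LS nSL] E.
have [l ul lE] := seqE _ (sub_finite_set LS fin).
have lL : [set` l] `<=` Lambda X A by rewrite -lE => lam /LS[].
have [lam0 Slam0 nlam0] : exists2 lam0, Lambda_star X A lam0 & ~ L lam0.
  apply: contrapT => no; apply: nSL => lam Sl.
  by apply: contrapT => nl; apply: no; exists lam.
have Ll0 : Lambda X A lam0 by case: Slam0.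
have := Lambda_star_irredundant X0 LS Slam0 nlam0; rewrite lE.
move=> /(separate_circuit X0 lL Ll0)[y [ly y0]].
have [b [Nl lb sfin _]] := Lambda_econe X0 Ll0.
(* The amount by which [y] violates the inequality of [lam0], all of which can be spent on the shift
   at [b]. *)
pose eta := - (\sum_a lam0 0 a * y 0 a + fine (sigA X A lam0)).
pose c := violated_signomial b lam0 y eta.
have : age_cone X A lam0 c by apply: violated_signomial_age; rewrite // /eta opprK.
move=> /(age_sub_sage X0 Nl lb sfin) cb.
have : sage_cone_all X A c.
  exists (fun b' => if b' == b then c else 0); split=> [b'|].
    by case: eqP => [->|_] //; exact: sage_cone0.
  by rewrite (bigD1 b) //= eqxx big1 ?addr0 // => b' /negPf ->.
rewrite E lE minkowski_sum_seq // => -[d [dl cE]].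
have : \sum_a c 0 a * expR (y 0 a) < 0.
  by apply: violated_signomial_lt0; rewrite // /eta oppr_gt0.
rewrite ltNge cE => /negP; apply.
under eq_bigr do rewrite summxE mulr_suml.
rewrite exchange_big big_seq; apply: sumr_ge0 => lam ll /=.
have [b' [Nl' lb' _ _]] := Lambda_econe X0 (lL _ ll).
exact: (age_cone_dual Nl' lb' (dl _ ll) (ly _ ll)).
Qed.
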